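(* Fix $0<p<\infty$. A positive finite Borel measure $\mu$ on $\mathbb{T}$ which is singular with respect to the Lebesgue measure $m$ is $\mathcal{L}(p)$-invisible if and only if $\mu(E)=0$ for any $\mathcal{C}(p)$-Beurling--Carleson set $E$.
   Context: $\mathbb{D}$ is the open unit disc in $\mathbb{C}$, $\mathbb{T}$ the unit circle, $m$ the normalized Lebesgue measure on $\mathbb{T}$; $L^p(\mathbb{T})$ is with respect to $m$. For a finite positive Borel measure $\nu$ on $\mathbb{T}$ singular with respect to $m$, the corresponding singular inner function is $S_\nu(z)=\exp\left(-\int_{\mathbb{T}}\frac{\xi+z}{\xi-z}\,d\nu(\xi)\right)$, $z\in\mathbb{D}$. Angular derivative: an analytic $f:\mathbb{D}\to\mathbb{D}$ has a finite angular derivative at $\xi\in\mathbb{T}$ if $\lim_{r\to1}f(r\xi)$ exists and belongs to $\mathbb{T}$ and $\lim_{r\to1}f'(r\xi)$ exists finitely; in this case $|f'(\xi)|:=\lim_{r\to1}|f'(r\xi)|$. If $f$ does not have a finite angular derivative at $\xi$, set $|f'(\xi)|:=\infty$ (and $\log|f'(\xi)|=\infty$). On $\mathbb{T}$, $|S_\nu'|$ denotes this function. A positive finite Borel measure $\mu$ on $\mathbb{T}$, singular with respect to $m$, is called $\mathcal{L}(p)$-invisible if for every non-trivial (nonzero) positive measure $\nu\le\mu$, the corresponding singular inner function $S_\nu$ satisfies $\log|S_\nu'|\notin L^p(\mathbb{T})$. For a closed set $E\subset\mathbb{T}$, $\operatorname{dist}(\xi,E)$ denotes the distance from $\xi$ to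 $E$. A closed subset $E\subset\mathbb{T}$ of Lebesgue measure zero is called a $\mathcal{C}(p)$-Beurling--Carleson set if $\int_{\mathbb{T}}|\log\operatorname{dist}(\xi,E)|^p\,dm(\xi)<\infty$. *)

(* Defs.v *)
From HB Require Import structures.
From mathcomp Require Import all_boot all_order all_algebra.
From mathcomp Require Import complex.
From mathcomp Require Import all_classical all_reals all_analysis measurable_realfun.

Set Implicit Arguments.
Unset Strict Implicit.
Unset Printing Implicit Defensive.

Import Order.TTheory GRing.Theory Num.Theory.
Import numFieldNormedType.Exports.

Local Open Scope classical_set_scope.
Local Open Scope complex_scope.
Local Open Scope ring_scope.

Notation normc := ComplexField.Normc.normc.

(* The norm topology and the complex derivative live on R[i]^o, the field of
   complex numbers seen as a normed module over itself. *)
Definition circle (R : realType) : Type := [set z : R[i]^o | `|z| = 1].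

Section circle_structure.
Variable R : realType.

Definition circle_val (xi : circle R) : R[i]^o := set_val xi.

HB.instance Definition _ :=
  Topological.copy (circle R) (set_type [set z : R[i]^o | `|z| = 1]).

Lemma normr_expi (t : R) : `|(cos t +i* sin t : R[i]^o)| = 1.
Proof. by rewrite normc_def /= cos2Dsin2 sqrtr1. Qed.

Definition expi (t : measurableTypeR R) : circle R := SigSub (mem_set (normr_expi t)).

HB.instance Definition _ := isPointed.Build (circle R) (expi 0).

(* Borel sigma-algebra of the topology induced from the plane. *)
HB.instance Definition _ :=
  Measurable.copy (circle R) (g_sigma_algebraType (@open (circle R))).

Lemma continuous_expi_val :
  continuous (fun t : R => cos t +i* sin t : R[i]^o).
Proof.
move=> t; apply/cvgrPdist_lt => /= -[e e'] e0.
have : 0 < e by move: e0; rewrite ltcE /= => /andP[].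
have -> : e' = 0 by move: e0; rewrite ltcE /= => /andP[/eqP].
move=> {}e0.
have e20 : 0 < e / 2 by rewrite divr_gt0.
have /cvgrPdist_lt /(_ _ e20) Hc := @continuous_cos R t.
have /cvgrPdist_lt /(_ _ e20) Hs := @continuous_sin R t.
near=> u.
have -> : (cos t +i* sin t) - (cos u +i* sin u) =
    (cos t - cos u)%:C + 'i * (sin t - sin u)%:C :> R[i].
  by simpc.
apply: (le_lt_trans (ler_normD _ _)).
rewrite normrM normc_def [ `|'i| ]normc_def [ `|_%:C| ]normc_def /=.
rewrite !expr0n /= !expr1n !addr0 !add0r !sqrtr_sqr sqrtr1 mul1r.
rewrite -rmorphD /= -[_ +i* 0]/(_%:C) ltcR [ltRHS]splitr ltrD //.
- by near: u.
- by near: u.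
Unshelve. all: by end_near. Qed.

Lemma measurable_expi : measurable_fun setT expi.
Proof.
apply: (measurability (@open (circle R))) => // _ [U [V oV <-] <-].
rewrite setTI; apply: open_measurable.
have /continuousP := continuous_expi_val.
by apply.
Qed.

HB.instance Definition _ :=
  isMeasurableFun.Build _ _ _ _
    expi measurable_expi.

Lemma lt0_2pi : 0 < pi *+ 2 :> R.
Proof. by rewrite mulrn_wgt0 ?pi_gt0. Qed.

Definition circle_measure : probability (circle R) R :=
  distribution (uniform_prob lt0_2pi) expi.

End circle_structure.

Section singular_inner_function.
Variable R : realType.
Implicit Types (nu : {measure set (circle R) -> \bar R}) (z : R[i]^o).

(* exp (x + i y) = e^x (cos y + i sin y). *)
Definition cexp z : R[i]^o :=
  (expR (complex.Re z))%:C * (cos (complex.Im z) +i* sin (complex.Im z)).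

Definition complex_integral nu (f : circle R -> R[i]^o) : R[i]^o :=
  \int[nu]_xi complex.Re (f xi) +i* \int[nu]_xi complex.Im (f xi).

(* Only meaningful for `|z| < 1, where the integrand is bounded and
   continuous; derivatives are taken at points of the open disc. *)
Definition singular_inner nu (z : R[i]^o) : R[i]^o :=
  cexp (- complex_integral nu
            (fun xi => (circle_val xi + z) / (circle_val xi - z))).

Definition mutually_singular (mu nu : {measure set (circle R) -> \bar R}) :=
  exists N : set (circle R),
    [/\ measurable N, mu (~` N) = 0%E & nu N = 0%E].

End singular_inner_function.

Section angular_derivative.
Variable R : realType.
Implicit Types (f : R[i]^o -> R[i]^o) (xi : circle R).

Definition finite_angular_derivative f xi :=
  (exists2 w : R[i]^o, `|w| = 1 &
     f (r%:C * circle_val xi) @[r --> (1 : R)^'-] --> w) /\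
  (exists l : R[i]^o,
     derive1 f (r%:C * circle_val xi) @[r --> (1 : R)^'-] --> l).

Definition abs_angular_derivative f xi : \bar R :=
  if `[< finite_angular_derivative f xi >]
  then (lim (normc (derive1 f (r%:C * circle_val xi)) @[r --> (1 : R)^'-]))%:E
  else +oo%E.

End angular_derivative.

Section invisibility.
Variables (R : realType) (p : R).
Local Open Scope ereal_scope.

(* Membership in L^p for extended-real-valued functions; Lfun only covers
   real-valued ones. *)
Definition in_Lp (f : circle R -> \bar R) :=
  measurable_fun setT f /\ 'N[circle_measure R]_(p%:E)[f] < +oo.

Definition invisible (mu : {measure set (circle R) -> \bar R}) :=
  forall nu : {measure set (circle R) -> \bar R},
    nu setT != 0 ->
    (forall A, measurable A -> nu A <= mu A) ->
    ~ in_Lp (fun xi => lne (abs_angular_derivative (singular_inner nu) xi)).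

(* Equals +oo when E is empty, so set0 fails beurling_carleson; nothing depends
   on this, since a measure vanishes on set0 anyway. *)
Definition circle_dist (xi : circle R) (E : set (circle R)) : \bar R :=
  ereal_inf [set (normc (circle_val xi - circle_val eta))%:E | eta in E].

(* On E itself lne 0 = -oo, so the integrand is +oo there, on a null set. *)
Definition beurling_carleson (E : set (circle R)) :=
  [/\ closed E, circle_measure R E = 0 &
      \int[circle_measure R]_xi (`|lne (circle_dist xi E)| `^ p) < +oo].

End invisibility.

(* Main.v *)
Require Import Defs.
From mathcomp Require Import all_boot all_order all_algebra.
From mathcomp Require Import complex ring lra.
From mathcomp Require Import all_classical all_reals all_analysis.
From mathcomp Require Import measurable_realfun.

Set Implicit Arguments.
Unset Strict Implicit.
Unset Printing Implicit Defensive.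

Import Order.TTheory GRing.Theory Num.Theory.
Import numFieldNormedType.Exports.

Local Open Scope classical_set_scope.
Local Open Scope complex_scope.
Local Open Scope ring_scope.

(** The proof passes through the potential
    [u(xi) = \int 2 / |eta - xi|^2 dnu(eta)], with values in [[0, +oo]].

    Writing [S_nu = exp(-H)] with [H] the Herglotz transform of [nu], the
    derivative of [S_nu] is [-H' S_nu].  On the circle [H] is formally purely
    imaginary and the integrand of [H'] has constant argument, so that
    [|S_nu'(xi)| = u(xi)]; this holds at every point, with both sides infinite
    together ([abs_angular_derivative_potential]).  If the angular derivative is
    finite, the mean value theorem along the radius bounds the Poisson integral
    of [nu] by a multiple of [1 - r], and Fatou's lemma gives [u(xi) < +oo].
    Conversely, when [u(xi)] is finite, a multiple of the kernel of [u] dominates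
    the kernels of [H] and [H'] along the radius, and both converge.

    Invisibility is therefore a question about the logarithm of a potential.

    If [E] is a Beurling-Carleson set charged by [mu], take for [nu] the
    restriction of [mu] to [E].  Then [u] is bounded below by a positive constant
    and above by a multiple of [dist(., E)^-2], so [|ln u|] is at most a constant
    plus [2 |ln dist(., E)|] and lies in [L^p] ([beurling_carleson_visible]).

    If conversely [ln u] is in [L^p], cover the circle, for each [n], by about
    [4^n] balls of radius about [4^-n] and discard those of mass below [c 8^-n].
    The discarded masses are summable over [n], and a small [c] leaves a set of
    positive mass on which [nu] gives mass at least [c 8^-n] to balls of radius
    [4 * 4^-n] about its points.  Because [8^-n] is much larger than the [16^-n]
    of the kernel, [u] is at least a multiple of [dist(., F)^(-1/2)] as soon as
    [F] is contained in that set.  By inner regularity [F] can be chosen closed,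
    of positive mass, and inside a Lebesgue-null carrier of [nu]; it is then a
    Beurling-Carleson set ([exists_beurling_carleson]).  Singularity of [nu]
    enters only through this null carrier. *)

(** * Complex numbers: modulus, limits and the exponential *)

Section complex_prelim.
Variable R : realType.
Implicit Types (z w : R[i]) (x y : R).

Lemma normrE_normc z : `|z| = (normc z)%:C.
Proof. by []. Qed.

Lemma normc_ge0 z : 0 <= normc z.
Proof. by case: z => a b; rewrite sqrtr_ge0. Qed.

Lemma sqr_normc z : normc z ^+ 2 = complex.Re z ^+ 2 + complex.Im z ^+ 2.
Proof. by case: z => a b /=; rewrite sqr_sqrtr// addr_ge0 ?sqr_ge0. Qed.

Lemma normc_triangle z w : normc (z + w) <= normc z + normc w.
Proof. exact: le_normcD. Qed.

Lemma normcNE z : normc (- z) = normc z.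
Proof. exact: normcN. Qed.

Lemma normcBC z w : normc (z - w) = normc (w - z).
Proof. by rewrite -normcNE opprB. Qed.

Lemma normc_triangleB z w : normc (z - w) <= normc z + normc w.
Proof. by rewrite -[normc w]normcNE normc_triangle. Qed.

Lemma normc_dist_triangle u z w : normc (z - w) <= normc (z - u) + normc (u - w).
Proof. by rewrite -[z - w](subrKA u) normc_triangle. Qed.

Lemma normcMr z w : normc (z * w) = normc z * normc w.
Proof. exact: Normc.normcM. Qed.

Lemma normcVr z : normc z^-1 = (normc z)^-1.
Proof. exact: Normc.normcV. Qed.

Lemma normcXr z n : normc (z ^+ n) = normc z ^+ n.
Proof.
by elim: n => [|n IH]; rewrite ?expr0 ?Normc.normc1// !exprS normcMr IH.
Qed.

Lemma normc_real x : normc x%:C = `|x|.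
Proof. by rewrite /= expr0n addr0 sqrtr_sqr. Qed.

Lemma normc_eq0 z : (normc z == 0) = (z == 0).
Proof.
by apply/eqP/eqP => [/Normc.eq0_normc//|->]; exact: Normc.normc0.
Qed.

Lemma normc_gt0 z : (0 < normc z) = (z != 0).
Proof. by rewrite lt_def normc_ge0 andbT normc_eq0. Qed.

Lemma Re_le_normc z : `|complex.Re z| <= normc z.
Proof.
by have := normc_ge_Re z; rewrite normrE_normc lecR.
Qed.

Lemma Im_le_normc z : `|complex.Im z| <= normc z.
Proof.
case: z => a b /=; rewrite -sqrtr_sqr ler_sqrt; last by rewrite addr_ge0 ?sqr_ge0.
by rewrite lerDr sqr_ge0.
Qed.

Lemma normc_le_ReIm z : normc z <= `|complex.Re z| + `|complex.Im z|.
Proof.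
rewrite -(@ler_pXn2r _ 2) ?nnegrE ?normc_ge0 ?addr_ge0//.
rewrite sqr_normc sqrrD !real_normK ?num_real//.
by rewrite addrAC lerDl mulrn_wge0// mulr_ge0.
Qed.

Lemma ReB z w : complex.Re (z - w) = complex.Re z - complex.Re w.
Proof. by case: z w => ? ? [? ?]. Qed.

Lemma ImB z w : complex.Im (z - w) = complex.Im z - complex.Im w.
Proof. by case: z w => ? ? [? ?]. Qed.

Lemma ReD z w : complex.Re (z + w) = complex.Re z + complex.Re w.
Proof. by case: z w => ? ? [? ?]. Qed.

Lemma ImD z w : complex.Im (z + w) = complex.Im z + complex.Im w.
Proof. by case: z w => ? ? [? ?]. Qed.

Lemma ReM z w : complex.Re (z * w) =
  complex.Re z * complex.Re w - complex.Im z * complex.Im w.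
Proof. by case: z w => ? ? [? ?]. Qed.

Lemma ImM z w : complex.Im (z * w) =
  complex.Re z * complex.Im w + complex.Im z * complex.Re w.
Proof. by case: z w => ? ? [? ?]. Qed.

Lemma Re_realM x z : complex.Re (x%:C * z) = x * complex.Re z.
Proof. by rewrite ReM /= mul0r subr0. Qed.

Lemma ReV z : complex.Re z^-1 = complex.Re z / (normc z ^+ 2).
Proof. by rewrite sqr_normc; case: z. Qed.

Lemma ImV z : complex.Im z^-1 = - complex.Im z / (normc z ^+ 2).
Proof. by rewrite sqr_normc mulNr; case: z. Qed.

Lemma cvg_normcP {T} {F : set_system T} {FF : Filter F} (f : T -> R[i]^o) (l : R[i]^o) :
  f x @[x --> F] --> l <->
  (forall e : R, 0 < e -> \forall x \near F, normc (l - f x) < e).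
Proof.
split=> [/cvgrPdist_lt h e e0|h].
  have /h : 0 < e%:C by rewrite ltcR.
  by apply: filterS => x; rewrite normrE_normc ltcR.
apply/cvgrPdist_lt => -[e e'] e0.
move: e0; rewrite ltcE /= => /andP[/eqP -> e0].
by apply: filterS (h _ e0) => x; rewrite normrE_normc -[e +i* 0]/(e%:C) ltcR.
Qed.

Lemma cvg_ReIm {T} {F : set_system T} {FF : Filter F} (f : T -> R[i]^o) (l : R[i]^o) :
  f x @[x --> F] --> l <->
  (complex.Re (f x) @[x --> F] --> complex.Re l /\
   complex.Im (f x) @[x --> F] --> complex.Im l).
Proof.
split=> [/cvg_normcP h|[/cvgrPdist_lt hr /cvgrPdist_lt hi]].
  split; apply/cvgrPdist_lt => e /h; apply: filterS => x.
    by apply: le_lt_trans; rewrite -ReB Re_le_normc.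
  by apply: le_lt_trans; rewrite -ImB Im_le_normc.
apply/cvg_normcP => e e0; have e20 : 0 < e / 2 by rewrite divr_gt0.
near=> x; apply: le_lt_trans (normc_le_ReIm _) _.
rewrite ReB ImB [ltRHS]splitr ltrD//.
- by near: x; exact: hr.
- by near: x; exact: hi.
Unshelve. all: by end_near. Qed.

Lemma cvg_normc {T} {F : set_system T} {FF : Filter F} (f : T -> R[i]^o) (l : R[i]^o) :
  f x @[x --> F] --> l -> (normc (f x) : R) @[x --> F] --> (normc l : R).
Proof.
move=> /cvg_normcP h; apply/cvgrPdist_lt => e /h.
apply: filterS => x; apply: le_lt_trans.
have := normc_triangle (l - f x) (f x); have := normc_triangle (f x - l) l.
rewrite !subrK (normcBC (f x)) ler_norml => h1 h2.
by apply/andP; split; lra.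
Qed.

Section complex_limits.
Context {T : Type} {F : set_system T} {FF : Filter F}.
Implicit Types (f g : T -> R[i]^o) (a b : R[i]^o).

Lemma complex_cvgN f a : f x @[x --> F] --> a -> (- f x : R[i]^o) @[x --> F] --> (- a : R[i]^o).
Proof.
move=> /cvg_normcP h; apply/cvg_normcP => e e0.
by apply: filterS (h _ e0) => x; rewrite -opprD normcNE.
Qed.

Lemma complex_cvgD f g a b : f x @[x --> F] --> a -> g x @[x --> F] --> b ->
  (f x + g x : R[i]^o) @[x --> F] --> (a + b : R[i]^o).
Proof.
move=> /cvg_ReIm[fr fi] /cvg_ReIm[gr gi]; apply/cvg_ReIm; split.
  by rewrite ReD; under eq_cvg do rewrite ReD; exact: (cvgD fr gr).
by rewrite ImD; under eq_cvg do rewrite ImD; exact: (cvgD fi gi).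
Qed.

Lemma complex_cvgB f g a b : f x @[x --> F] --> a -> g x @[x --> F] --> b ->
  (f x - g x : R[i]^o) @[x --> F] --> (a - b : R[i]^o).
Proof. move=> fa gb; exact: (complex_cvgD fa (complex_cvgN gb)). Qed.

Lemma complex_cvgM f g a b : f x @[x --> F] --> a -> g x @[x --> F] --> b ->
  (f x * g x : R[i]^o) @[x --> F] --> (a * b : R[i]^o).
Proof.
move=> /cvg_ReIm[fr fi] /cvg_ReIm[gr gi]; apply/cvg_ReIm; split.
  by rewrite ReM; under eq_cvg do rewrite ReM; exact: (cvgB (cvgM fr gr) (cvgM fi gi)).
by rewrite ImM; under eq_cvg do rewrite ImM; exact: (cvgD (cvgM fr gi) (cvgM fi gr)).
Qed.

Lemma complex_cvgV f a : a != 0 -> f x @[x --> F] --> a ->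
  ((f x)^-1 : R[i]^o) @[x --> F] --> (a^-1 : R[i]^o).
Proof.
move=> a0 fa; have na : (normc (f x) : R) @[x --> F] --> (normc a : R) by exact: cvg_normc.
have n0 : normc a ^+ 2 != 0 by rewrite sqrf_eq0 normc_eq0.
have nV : ((normc (f x) ^+ 2)^-1 : R) @[x --> F] --> ((normc a ^+ 2)^-1 : R).
  exact: (cvgV n0 (cvgM na na)).
move: fa => /cvg_ReIm[fr fi]; apply/cvg_ReIm; split.
  by rewrite ReV; under eq_cvg do rewrite ReV; exact: (cvgM fr nV).
by rewrite ImV; under eq_cvg do rewrite ImV; exact: (cvgM (cvgN fi) nV).
Qed.

End complex_limits.

End complex_prelim.

Section complex_exponential.
Variable R : realType.
Implicit Types (z w h D : R[i]^o) (f : R[i]^o -> R[i]^o).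

Lemma Re_cexp z : complex.Re (cexp z) = expR (complex.Re z) * cos (complex.Im z).
Proof. by rewrite ReM /= mul0r subr0. Qed.

Lemma Im_cexp z : complex.Im (cexp z) = expR (complex.Re z) * sin (complex.Im z).
Proof. by rewrite ImM /= mul0r addr0. Qed.

Lemma normc_cexp z : normc (cexp z) = expR (complex.Re z).
Proof.
by rewrite normcMr normc_real ger0_norm ?expR_ge0//= cos2Dsin2 sqrtr1 mulr1.
Qed.

Lemma cexp0 : cexp (0 : R[i]^o) = 1.
Proof. by rewrite /cexp /= expR0 cos0 sin0 mul1r. Qed.

Lemma cexpD z w : cexp (z + w) = cexp z * cexp w.
Proof.
apply/eqP; rewrite eq_complex Re_cexp Im_cexp (ReM (cexp z)) (ImM (cexp z)).
rewrite !Re_cexp !Im_cexp ReD ImD expRD cosD sinD.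
by apply/andP; split; apply/eqP; ring.
Qed.

Lemma cvg_cexp {T} {F : set_system T} {FF : Filter F} (f : T -> R[i]^o) (l : R[i]^o) :
  f x @[x --> F] --> l -> cexp (f x) @[x --> F] --> cexp l.
Proof.
move=> /cvg_ReIm[fr fi]; apply/cvg_ReIm; split; rewrite ?Re_cexp ?Im_cexp.
  under eq_cvg do rewrite Re_cexp.
  apply: cvgM; first by apply: continuous_cvg fr; exact: continuous_expR.
  by apply: continuous_cvg fi; exact: continuous_cos.
under eq_cvg do rewrite Im_cexp.
apply: cvgM; first by apply: continuous_cvg fr; exact: continuous_expR.
by apply: continuous_cvg fi; exact: continuous_sin.
Qed.

(** This form of differentiability composes easily with the exponential and
    restricts to real lines, where the base field changes from [R[i]] to [R]. *)
Definition complex_derivative f z D :=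
  forall e : R, 0 < e -> exists2 d : R, 0 < d &
    forall h, normc h < d -> normc (f (z + h) - f z - D * h) <= e * normc h.

Lemma complex_derivative_derive1 f z D :
  complex_derivative f z D -> derive1 f z = D.
Proof.
move=> fD; rewrite /derive1; apply: cvg_lim => //.
apply/cvg_normcP => e e0; have e20 : 0 < e / 2 by rewrite divr_gt0.
have [d d0 hd] := fD _ e20.
apply/nbhs_ballP; exists d%:C => /=; first by rewrite ltcR.
move=> h; rewrite /ball /= sub0r normrN normrE_normc ltcR => hd1 h0.
have hn0 : 0 < normc h by rewrite normc_gt0.
rewrite /GRing.scale /=.
have -> : D - h^-1 * (f (h + z) - f z) = - (h^-1 * (f (z + h) - f z - D * h)).
  by rewrite [h + z]addrC; field.
rewrite normcNE normcMr normcVr ltr_pdivrMl// (le_lt_trans (hd _ hd1))//.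
by rewrite mulrC ltr_pM2l// ltr_pdivrMr// mulr_natr mulr2n ltrDr.
Qed.

Lemma is_derive_small (f : R -> R) (x l e : R) : is_derive x 1 f l -> 0 < e ->
  exists2 d : R, 0 < d & forall t, `|t| < d -> `|f (x + t) - f x - l * t| <= e * `|t|.
Proof.
move=> [fd fl] e0.
have : h^-1 *: (f (h *: (1 : R) + x) - f x) @[h --> 0^'] --> l by rewrite -fl.
move=> /cvgrPdist_lt /(_ _ e0); move=> /nbhs_ballP[d /= d0 hd].
exists d => // t td; have [->|t0] := eqVneq t 0.
  by rewrite addr0 subrr mulr0 subr0 normr0 mulr0.
have := hd t; rewrite /ball /= sub0r normrN => /(_ td t0).
rewrite /GRing.scale /= mulr1 => /ltW.
have -> : l - t^-1 * (f (t + x) - f x) = - (t^-1 * (f (x + t) - f x - l * t)).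
  by rewrite [t + x]addrC; field.
by rewrite normrN normrM normfV ler_pdivrMl ?normr_gt0// [_ * e]mulrC.
Qed.

Lemma complex_derivative_cexp0 : complex_derivative (@cexp R) 0 1.
Proof.
move=> e e0.
have [k [k0 k1 ke]] : exists k : R, [/\ 0 < k, k <= 1 & k * 10 <= e].
  exists (Num.min (e / 10) 1); split.
  - by rewrite lt_min divr_gt0/=.
  - by rewrite ge_min lexx orbT.
  - by rewrite -ler_pdivlMr// ge_min lexx.
have [d1 d10 h1] := is_derive_small (is_derive_expR 0) k0.
have [d2 d20 h2] := is_derive_small (is_derive_cos 0) k0.
have [d3 d30 h3] := is_derive_small (is_derive_sin 0) k0.
exists (Num.min (Num.min d1 d2) (Num.min d3 k)).
  by rewrite !lt_min d10 d20 d30 k0.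
move=> h; rewrite !lt_min => /andP[/andP[hd1 hd2] /andP[hd3 hk]].
have hx := Re_le_normc h; have hy := Im_le_normc h.
have hn := normc_ge0 h.
rewrite add0r cexp0 mul1r.
apply: le_trans (normc_le_ReIm _) _.
rewrite !ReB !ImB Re_cexp Im_cexp /=.
set x := complex.Re h in hx *; set y := complex.Im h in hy *.
have := h1 x (le_lt_trans hx hd1); have := h2 y (le_lt_trans hy hd2).
have := h3 y (le_lt_trans hy hd3).
rewrite !add0r expR0 cos0 sin0 oppr0 !mul0r !mul1r !subr0 ?addr0.
set E := expR x; set c := cos y; set s := sin y => hs hc hE; clearbody E c s x y.
have kn : 0 <= k * normc h by rewrite mulr_ge0// ltW.
have kx : k * `|x| <= k * normc h by rewrite ler_pM2l.
have ky : k * `|y| <= k * normc h by rewrite ler_pM2l.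
have E1 : `|E - 1| <= 2 * k.
  rewrite -[E - 1](subrK x) (le_trans (ler_normD _ _))//.
  have kk : k * normc h <= k * 1 by rewrite ler_pM2l// ltW// (lt_le_trans hk).
  lra.
have E2 : `|E| <= 3 by rewrite -[E](subrK 1) (le_trans (ler_normD _ _))// normr1; lra.
have s1 : `|s| <= 2 * normc h.
  rewrite -[s](subrK y) (le_trans (ler_normD _ _))//.
  have : k * normc h <= 1 * normc h by rewrite ler_wpM2r.
  lra.
(* Both coordinates of the remainder are split so that each term contains one
   of the first-order errors of [expR], [cos] and [sin]. *)
have -> : E * c - 1 - x = (E - 1 - x) + E * (c - 1) by ring.
have -> : E * s - y = (E - 1) * s + (s - y) by ring.
have a1 : `|E * (c - 1)| <= 3 * (k * normc h).
  by rewrite normrM ler_pM// (le_trans hc).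
have a2 : `|(E - 1) * s| <= 2 * k * (2 * normc h).
  by rewrite normrM ler_pM//.
have a3 := ler_normD (E - 1 - x) (E * (c - 1)).
have a4 := ler_normD ((E - 1) * s) (s - y).
have : k * 10 * normc h <= e * normc h by rewrite ler_wpM2r.
lra.
Qed.

Lemma complex_derivative_cexpN f z D : complex_derivative f z D ->
  complex_derivative (fun z => cexp (- f z)) z (- (D * cexp (- f z))).
Proof.
move=> fD e e0.
set c := normc (cexp (- f z)).
have c0 : 0 < c by rewrite /c normc_cexp expR_gt0.
pose M := normc D + 1.
have M0 : 0 < M by rewrite /M ltr_wpDl// normc_ge0.
have [k [k0 k1 ke]] : exists k : R, [/\ 0 < k, k <= 1 & k * (4 * c) <= e].
  exists (Num.min (e / (4 * c)) 1); split.
  - by rewrite lt_min divr_gt0 ?mulr_gt0/=.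
  - by rewrite ge_min lexx orbT.
  - by rewrite -ler_pdivlMr ?mulr_gt0// ge_min lexx.
have [d d0 hd] := fD _ k0.
have kM : 0 < k / M by rewrite divr_gt0.
have [d1 d10 hd1] := complex_derivative_cexp0 kM.
exists (Num.min d (d1 / M)); first by rewrite lt_min d0 divr_gt0.
move=> h; rewrite lt_min => /andP[hd2]; rewrite ltr_pdivlMr// => hd3.
have hn := normc_ge0 h.
have := hd _ hd2.
set t := f (z + h) - f z => ht.
have tM : normc t <= M * normc h.
  rewrite -[t](subrK (D * h)) (le_trans (normc_triangle _ _))//.
  have : k * normc h <= 1 * normc h by rewrite ler_wpM2r.
  rewrite normcMr /M; lra.
have := hd1 (- t); rewrite normcNE.
have td : normc t < d1 by rewrite (le_lt_trans tM)// mulrC.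
move=> /(_ td); rewrite add0r cexp0 mul1r => ht2.
have -> : - f (z + h) = - f z + - t by rewrite /t; ring.
rewrite cexpD.
have -> : cexp (- f z) * cexp (- t) - cexp (- f z) - - (D * cexp (- f z)) * h =
  cexp (- f z) * ((cexp (- t) - 1 - - t) - (t - D * h)) by ring.
rewrite normcMr -/c.
have := normc_triangleB (cexp (- t) - 1 - - t) (t - D * h).
have : k / M * normc t <= k * normc h.
  by rewrite -mulrA ler_pM2l// ler_pdivrMl.
move=> b1 b2; apply: (@le_trans _ _ (c * (2 * (k * normc h)))).
  rewrite ler_pM2l//; lra.
have : k * (4 * c) * normc h <= e * normc h by rewrite ler_wpM2r.
have : 0 <= c * k * normc h by rewrite !mulr_ge0// ltW.
lra.
Qed.

(** Along a line, the real part inherits its derivative from the complex one;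
    this is what lets the real mean value theorem act on radii. *)
Lemma complex_derivative_Re f (w : R[i]^o) (D : R -> R[i]^o) (r : R) :
  normc w = 1 -> complex_derivative f (r%:C * w) (D r) ->
  is_derive r 1 (fun t : R => complex.Re (f (t%:C * w))) (complex.Re (w * D r)).
Proof.
move=> w1 fD.
have H : h^-1 *: (complex.Re (f ((h *: 1 + r)%:C * w)) - complex.Re (f (r%:C * w)))
    @[h --> (0:R)^'] --> complex.Re (w * D r).
  apply/cvgrPdist_lt => e e0; have e20 : 0 < e / 2 by rewrite divr_gt0.
  have [d d0 hd] := fD _ e20.
  apply/nbhs_ballP; exists d => //= h.
  rewrite /ball /= sub0r normrN => hd1 h0.
  have hw : normc (h%:C * w) = `|h| by rewrite normcMr normc_real w1 mulr1.
  have := hd (h%:C * w); rewrite hw => /(_ hd1).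
  have -> : r%:C * w + h%:C * w = (h *: 1 + r)%:C * w.
    by rewrite /GRing.scale /= mulr1 addrC rmorphD mulrDl.
  move=> /(le_trans (Re_le_normc _)).
  rewrite !ReB (mulrC (D r)) -mulrA Re_realM.
  set X := _ - complex.Re (f (r%:C * w)); set Y := complex.Re (w * D r) => hX.
  rewrite /GRing.scale /=.
  have -> : Y - h^-1 * X = - (h^-1 * (X - h * Y)) by field.
  rewrite normrN normrM normfV ltr_pdivrMl ?normr_gt0// (le_lt_trans hX)//.
  by rewrite mulrC ltr_pM2l ?normr_gt0// ltr_pdivrMr// mulr_natr mulr2n ltrDr.
apply: DeriveDef; first by apply/cvg_ex; exists (complex.Re (w * D r)).
by apply: cvg_lim.
Qed.

End complex_exponential.

(** * Measurability on the circle *)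

Section circle_measurability.
Variable R : realType.
Implicit Types (xi eta : circle R).

Lemma normc_circle xi : normc (circle_val xi) = 1.
Proof.
have /set_mem /= := valP xi; rewrite -/(circle_val xi) normrE_normc.
by case.
Qed.

Lemma circle_val_inj : injective (@circle_val R).
Proof. exact: val_inj. Qed.

Lemma continuous_circle_val : continuous (@circle_val R).
Proof. exact: initial_continuous. Qed.

Lemma measurable_fun_circle (f : circle R -> R) :
  continuous f -> measurable_fun setT f.
Proof.
move=> /continuousP cf; apply: (measurability _ (RGenOpens.measurableE R)).
move=> _ [_ [a [b ->]] <-]; rewrite setTI.
by apply: sub_sigma_algebra; apply: cf; exact: interval_open.
Qed.

Lemma measurable_Re_circle : measurable_fun setT (fun xi => complex.Re (circle_val xi)).
Proof.
apply: measurable_fun_circle => xi.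
by have /cvg_ReIm[] := continuous_circle_val (x := xi).
Qed.

Lemma measurable_Im_circle : measurable_fun setT (fun xi => complex.Im (circle_val xi)).
Proof.
apply: measurable_fun_circle => xi.
by have /cvg_ReIm[] := continuous_circle_val (x := xi).
Qed.

End circle_measurability.

Section complex_measurability.
Context {R : realType} d (T : measurableType d).
Implicit Types f g : T -> R[i]^o.

Definition complex_measurable f :=
  measurable_fun setT (fun x => complex.Re (f x)) /\
  measurable_fun setT (fun x => complex.Im (f x)).

Lemma complex_measurable_cst (c : R[i]^o) : complex_measurable (fun=> c).
Proof. by split; exact: measurable_cst. Qed.

Lemma complex_measurableD f g : complex_measurable f -> complex_measurable g ->
  complex_measurable (fun x => f x + g x).
Proof.
move=> [fr fi] [gr gi]; split.
  by under eq_fun do rewrite ReD; exact: measurable_funD.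
by under eq_fun do rewrite ImD; exact: measurable_funD.
Qed.

Lemma complex_measurableB f g : complex_measurable f -> complex_measurable g ->
  complex_measurable (fun x => f x - g x).
Proof.
move=> [fr fi] [gr gi]; split.
  by under eq_fun do rewrite ReB; exact: measurable_funB.
by under eq_fun do rewrite ImB; exact: measurable_funB.
Qed.

Lemma complex_measurableM f g : complex_measurable f -> complex_measurable g ->
  complex_measurable (fun x => f x * g x).
Proof.
move=> [fr fi] [gr gi]; split.
  by under eq_fun do rewrite ReM; apply: measurable_funB; exact: measurable_funM.
by under eq_fun do rewrite ImM; apply: measurable_funD; exact: measurable_funM.
Qed.

Lemma measurable_sqr_normc f : complex_measurable f ->
  measurable_fun setT (fun x => normc (f x) ^+ 2).
Proof.
move=> [fr fi]; under eq_fun do rewrite sqr_normc.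
by apply: measurable_funD; exact: measurable_funX.
Qed.

Lemma complex_measurableV f : complex_measurable f ->
  complex_measurable (fun x => (f x)^-1).
Proof.
move=> mf; have mN : measurable_fun setT (fun x => (normc (f x) ^+ 2)^-1).
  under eq_fun do rewrite -powR_inv1 ?exprn_ge0 ?normc_ge0//.
  exact: measurableT_comp (measurable_powR _) (measurable_sqr_normc mf).
case: mf => fr fi; split.
  by under eq_fun do rewrite ReV; exact: measurable_funM.
under eq_fun do rewrite ImV; apply: measurable_funM => //.
exact: measurableT_comp.
Qed.

Lemma complex_measurableX f n : complex_measurable f ->
  complex_measurable (fun x => f x ^+ n).
Proof.
move=> mf; elim: n => [|n IH].
  by under eq_fun do rewrite expr0; exact: complex_measurable_cst.
by under eq_fun do rewrite exprS; exact: complex_measurableM.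
Qed.

End complex_measurability.

Lemma complex_measurable_circle (R : realType) : complex_measurable (@circle_val R).
Proof. split; [exact: measurable_Re_circle|exact: measurable_Im_circle]. Qed.

Section complex_integrals.
Variables (R : realType) (nu : {measure set (circle R) -> \bar R}).
Implicit Types (f g : circle R -> R[i]^o) (c : R[i]^o).

Definition complex_integrable f :=
  nu.-integrable setT (EFin \o (fun x => complex.Re (f x))) /\
  nu.-integrable setT (EFin \o (fun x => complex.Im (f x))).

Lemma complex_integrableB f g : complex_integrable f -> complex_integrable g ->
  complex_integrable (fun x => f x - g x).
Proof.
move=> [fr fi] [gr gi]; split.
  apply: eq_integrable (integrableB measurableT fr gr) => //= x _.
  by rewrite ReB EFinB.
apply: eq_integrable (integrableB measurableT fi gi) => //= x _.
by rewrite ImB EFinB.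
Qed.

Lemma complex_integralB f g : complex_integrable f -> complex_integrable g ->
  complex_integral nu (fun x => f x - g x) =
  complex_integral nu f - complex_integral nu g.
Proof.
move=> [fr fi] [gr gi]; apply/eqP; rewrite eq_complex /=; apply/andP; split.
  by rewrite -RintegralB//; apply/eqP; apply: eq_Rintegral => x _; rewrite ReB.
by rewrite -RintegralB//; apply/eqP; apply: eq_Rintegral => x _; rewrite ImB.
Qed.

Lemma complex_integrableZ c f : complex_integrable f ->
  complex_integrable (fun x => c * f x).
Proof.
move=> [fr fi]; split.
  apply: eq_integrable (integrableB measurableT
    (integrableZl measurableT (complex.Re c) fr)
    (integrableZl measurableT (complex.Im c) fi)) => //= x _.
  by rewrite ReM EFinB.
apply: eq_integrable (integrableD measurableT
    (integrableZl measurableT (complex.Re c) fi)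
    (integrableZl measurableT (complex.Im c) fr)) => //= x _.
by rewrite ImM EFinD.
Qed.

Lemma complex_integralZ c f : complex_integrable f ->
  complex_integral nu (fun x => c * f x) = c * complex_integral nu f.
Proof.
move=> [fr fi].
have ri : forall (k : R) (h : circle R -> R), nu.-integrable setT (EFin \o h) ->
    nu.-integrable setT (EFin \o (fun x => k * h x)).
  by move=> k h ih; apply: eq_integrable (integrableZl measurableT k ih).
apply/eqP; rewrite eq_complex ReM ImM /=; apply/andP; split; apply/eqP.
  rewrite -!RintegralZl// -RintegralB ?ri//.
  by apply: eq_Rintegral => x _; rewrite ReM.
rewrite -!RintegralZl// -RintegralD ?ri//.
by apply: eq_Rintegral => x _; rewrite ImM.
Qed.

Hypothesis nu_fin : (nu setT < +oo)%E.

Lemma bounded_Rintegrable (f : circle R -> R) (C : R) :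
  measurable_fun setT f -> (forall x, `|f x| <= C) ->
  nu.-integrable setT (EFin \o f).
Proof.
move=> mf fC; apply: measurable_bounded_integrable => //.
exists C; split; first exact: num_real.
by move=> M CM x _ /=; rewrite (le_trans (fC x)) ?ltW.
Qed.

Lemma normr_Rintegral_le (f : circle R -> R) (C : R) :
  measurable_fun setT f -> (forall x, `|f x| <= C) ->
  `|\int[nu]_x f x| <= C * fine (nu setT).
Proof.
move=> mf fC; have fi := bounded_Rintegrable mf fC.
apply: le_trans (le_normr_Rintegral _ fi) _ => //.
rewrite -Rintegral_cst//; apply: le_Rintegral => //.
- apply: (@bounded_Rintegrable _ C); first exact: measurableT_comp.
  by move=> x; rewrite normr_id.
- exact: (@bounded_Rintegrable _ `|C|).
Qed.

Lemma bounded_complex_integrable f (C : R) :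
  complex_measurable f -> (forall x, normc (f x) <= C) -> complex_integrable f.
Proof.
move=> [fr fi] fC; split.
  by apply: (@bounded_Rintegrable _ C) => // x; rewrite (le_trans (Re_le_normc _)).
by apply: (@bounded_Rintegrable _ C) => // x; rewrite (le_trans (Im_le_normc _)).
Qed.

Lemma normc_complex_integral_le f (C : R) :
  complex_measurable f -> (forall x, normc (f x) <= C) ->
  normc (complex_integral nu f) <= 2 * (C * fine (nu setT)).
Proof.
move=> [fr fi] fC; rewrite (le_trans (normc_le_ReIm _))//= mulr_natl mulr2n lerD//.
  by apply: normr_Rintegral_le => // x; rewrite (le_trans (Re_le_normc _)).
by apply: normr_Rintegral_le => // x; rewrite (le_trans (Im_le_normc _)).
Qed.

End complex_integrals.

Section complex_dominated.
Variables (R : realType) (nu : {measure set (circle R) -> \bar R}).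

(** The dominating function takes extended values, and convergence is asked only
    where it is finite: the kernels on the circle are singular at one point, which
    carries no mass as soon as the dominating function is integrable. *)
Lemma Rintegral_dominated_cvg (f_ : nat -> circle R -> R) (f : circle R -> R)
    (g : circle R -> \bar R) :
  (forall n, measurable_fun setT (f_ n)) -> measurable_fun setT f ->
  nu.-integrable setT g ->
  (forall n x, (`|f_ n x|%:E <= g x)%E) ->
  (forall x, (g x < +oo)%E -> f_ n x @[n --> \oo] --> f x) ->
  \int[nu]_x f_ n x @[n --> \oo] --> \int[nu]_x f x.
Proof.
move=> mf_ mf ig fg f_f.
have ae_f : {ae nu, forall x, setT x -> (EFin \o f_ n) x @[n --> \oo] --> (EFin \o f) x}.
  have [N [mN N0 hN]] := integrable_ae measurableT ig.
  exists N; split => // x /= nx; apply: hN => /= gx; apply: nx => _.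
  apply: cvg_EFin; first exact: nearW.
  apply: f_f; have := gx I; rewrite fin_numE => /andP[_ gy].
  by rewrite ltey.
have := dominated_convergence measurableT
  (f_ := fun n => EFin \o f_ n) (f := EFin \o f) (g := g).
move=> /(_ nu) [].
- by move=> n; exact/measurable_EFinP.
- exact/measurable_EFinP.
- exact: ae_f.
- exact: ig.
- by apply: aeW => x n _ /=; exact: fg.
move=> fi _ H.
apply: fine_cvg.
rewrite fineK; last exact: integrable_fin_num.
exact: H.
Qed.

Lemma complex_integral_dominated_cvg (f_ : nat -> circle R -> R[i]^o)
    (f : circle R -> R[i]^o) (g : circle R -> \bar R) :
  (forall n, complex_measurable (f_ n)) -> complex_measurable f ->
  nu.-integrable setT g ->
  (forall n x, ((normc (f_ n x))%:E <= g x)%E) ->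
  (forall x, (g x < +oo)%E -> f_ n x @[n --> \oo] --> f x) ->
  complex_integral nu (f_ n) @[n --> \oo] --> complex_integral nu f.
Proof.
move=> mf_ [fr fi] ig fg f_f; apply/cvg_ReIm; split => /=.
  apply: (Rintegral_dominated_cvg _ _ ig) => //.
  - by move=> n; case: (mf_ n).
  - by move=> n x; rewrite (le_trans _ (fg n x))// lee_fin Re_le_normc.
  - by move=> x /f_f /cvg_ReIm[].
apply: (Rintegral_dominated_cvg _ _ ig) => //.
- by move=> n; case: (mf_ n).
- by move=> n x; rewrite (le_trans _ (fg n x))// lee_fin Im_le_normc.
- by move=> x /f_f /cvg_ReIm[].
Qed.

End complex_dominated.

(** * Singular inner functions in the disc *)

Section herglotz_transform.
Variables (R : realType) (nu : {measure set (circle R) -> \bar R}).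
Hypothesis nu_fin : (nu setT < +oo)%E.
Implicit Types (z h : R[i]^o) (xi eta : circle R).

Definition herglotz z := complex_integral nu
  (fun eta => (circle_val eta + z) / (circle_val eta - z)).

Definition herglotz_deriv z := complex_integral nu
  (fun eta => 2 * circle_val eta / (circle_val eta - z) ^+ 2).

Lemma singular_innerE z : singular_inner nu z = cexp (- herglotz z).
Proof. by []. Qed.

Lemma normc_circleB_ge eta z : 1 - normc z <= normc (circle_val eta - z).
Proof.
rewrite lerBlDr -(normc_circle eta).
by rewrite -{1}(subrK z (circle_val eta)) normc_triangle.
Qed.

Lemma complex_measurable_herglotz z : complex_measurable
  (fun eta => (circle_val eta + z) / (circle_val eta - z)).
Proof.
have mc := complex_measurable_circle R; have mz := complex_measurable_cst (circle R) z.
apply: complex_measurableM; first exact: complex_measurableD.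
by apply: complex_measurableV; exact: complex_measurableB.
Qed.

Lemma complex_measurable_herglotz_deriv z : complex_measurable
  (fun eta => 2 * circle_val eta / (circle_val eta - z) ^+ 2).
Proof.
have mc := complex_measurable_circle R; have mz := complex_measurable_cst (circle R) z.
apply: complex_measurableM.
  by apply: complex_measurableM => //; exact: complex_measurable_cst.
by apply: complex_measurableV; apply: complex_measurableX; exact: complex_measurableB.
Qed.

Lemma normc2 : normc (2 : R[i]) = 2.
Proof. by rewrite -[2]/(2%:R) -(rmorph_nat (real_complex R)) normc_real ger0_norm. Qed.

Lemma herglotz_integrable z : normc z < 1 -> complex_integrable nu
  (fun eta => (circle_val eta + z) / (circle_val eta - z)).
Proof.
move=> z1; apply: (bounded_complex_integrable nu_fin (C := 2 / (1 - normc z))).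
  exact: complex_measurable_herglotz.
move=> eta; rewrite normcMr normcVr ler_pM ?invr_ge0 ?normc_ge0//.
  by rewrite (le_trans (normc_triangle _ _))// normc_circle; lra.
rewrite lef_pV2 ?posrE ?normc_circleB_ge// ?subr_gt0//.
by rewrite (lt_le_trans _ (normc_circleB_ge _ _))// subr_gt0.
Qed.

Lemma herglotz_deriv_integrable z : normc z < 1 -> complex_integrable nu
  (fun eta => 2 * circle_val eta / (circle_val eta - z) ^+ 2).
Proof.
move=> z1; apply: (bounded_complex_integrable nu_fin (C := 2 / (1 - normc z) ^+ 2)).
  exact: complex_measurable_herglotz_deriv.
have z10 : 0 < 1 - normc z by rewrite subr_gt0.
move=> eta; rewrite !normcMr normc2 normc_circle mulr1 normcVr normcXr ler_pM2l//.
have nz := normc_circleB_ge eta z; have nz0 := lt_le_trans z10 nz.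
by rewrite lef_pV2 ?posrE ?exprn_gt0// ler_pXn2r ?nnegrE ?(ltW z10) ?(ltW nz0).
Qed.

(** Differentiation under the integral: the difference quotients of the kernel
    have an explicit remainder, quadratic in [h] uniformly in [eta]. *)
Lemma herglotz_derivative z : normc z < 1 ->
  complex_derivative herglotz z (herglotz_deriv z).
Proof.
move=> z1 e e0; set d := 1 - normc z.
have d0 : 0 < d by rewrite subr_gt0.
pose m := fine (nu setT).
have m0 : 0 <= m by exact: fine_ge0.
pose K := 2 * (4 / d ^+ 3 * m) + 1.
have K0 : 0 < K by rewrite ltr_wpDl// !mulr_ge0// invr_ge0 exprn_ge0// ltW.
exists (Num.min (d / 2) (e / K)); first by rewrite lt_min !divr_gt0.
move=> h; rewrite lt_min => /andP[hd he].
have zh : normc (z + h) < 1.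
  by rewrite (le_lt_trans (normc_triangle _ _))//; rewrite /d in hd; lra.
pose rem eta := 2 * circle_val eta * h ^+ 2 /
  ((circle_val eta - z) ^+ 2 * (circle_val eta - (z + h))).
have ez eta : d <= normc (circle_val eta - z) by exact: normc_circleB_ge.
have ezh eta : d / 2 <= normc (circle_val eta - (z + h)).
  apply: le_trans (normc_circleB_ge _ _).
  have := normc_triangle z h; rewrite /d in hd *; lra.
have nz eta : circle_val eta - z != 0.
  by rewrite -normc_gt0 (lt_le_trans d0).
have nzh eta : circle_val eta - (z + h) != 0.
  by rewrite -normc_gt0 (lt_le_trans _ (ezh _))// divr_gt0.
have -> : herglotz (z + h) - herglotz z - herglotz_deriv z * h =
    complex_integral nu rem.
  rewrite [herglotz_deriv z * h]mulrC -complex_integralZ; last exact: herglotz_deriv_integrable.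
  have iz := herglotz_integrable z1; have izh := herglotz_integrable zh.
  rewrite -complex_integralB// -complex_integralB//; last 2 first.
  - exact: complex_integrableB.
  - by apply: complex_integrableZ; exact: herglotz_deriv_integrable.
  congr complex_integral; apply/funext => eta.
  rewrite /rem; have := nz eta; have := nzh eta.
  by move: (circle_val eta) => w w1 w2; field; rewrite w1 w2.
apply: (@le_trans _ _ (2 * (4 / d ^+ 3 * normc h ^+ 2 * m))).
  apply: normc_complex_integral_le => //.
    have mc := complex_measurable_circle R.
    have mz := complex_measurable_cst (circle R).
    apply: complex_measurableM.
      by apply: complex_measurableM => //; apply: complex_measurableM.
    apply: complex_measurableV; apply: complex_measurableM.
      by apply: complex_measurableX; exact: complex_measurableB.
    exact: complex_measurableB.
  move=> eta; rewrite /rem !normcMr normcVr normcMr !normcXr normc2 normc_circle mulr1.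
  have key : d ^+ 2 * (d / 2) <= normc (circle_val eta - z) ^+ 2 *
      normc (circle_val eta - (z + h)).
    by rewrite ler_pM ?exprn_ge0 ?lerXn2r ?nnegrE ?normc_ge0 ?(ltW d0)// divr_ge0// ltW.
  rewrite ler_pdivrMr ?mulr_gt0 ?exprn_gt0 ?normc_gt0//.
  have -> : 2 * normc h ^+ 2 = 4 / d ^+ 3 * normc h ^+ 2 * (d ^+ 2 * (d / 2)).
    by field; rewrite gt_eqF.
  by rewrite ler_wpM2l// !mulr_ge0 ?exprn_ge0 ?normc_ge0// invr_ge0 exprn_ge0// ltW.
have -> : 2 * (4 / d ^+ 3 * normc h ^+ 2 * m) = (K - 1) * normc h * normc h.
  by rewrite /K; ring.
rewrite ler_wpM2r ?normc_ge0//.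
apply: (@le_trans _ _ (K * normc h)); first by rewrite ler_wpM2r ?normc_ge0// gerBl.
by rewrite mulrC -ler_pdivlMr// ltW.
Qed.

Lemma derive1_singular_inner z : normc z < 1 ->
  derive1 (singular_inner nu) z = - (herglotz_deriv z * singular_inner nu z).
Proof.
move=> z1; apply: complex_derivative_derive1.
exact: (complex_derivative_cexpN (herglotz_derivative z1)).
Qed.

Lemma normc_singular_inner z :
  normc (singular_inner nu z) = expR (- complex.Re (herglotz z)).
Proof. by rewrite singular_innerE normc_cexp; case: (herglotz z). Qed.

End herglotz_transform.

(** * The angular derivative as a potential *)

Section potential.
Variables (R : realType) (nu : {measure set (circle R) -> \bar R}).
Implicit Types (xi eta : circle R).

Definition chord xi eta : R := normc (circle_val eta - circle_val xi).

(** The inverse is the one of the extended reals, so that the kernel is [+oo] on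
    the diagonal and an atom at [xi] makes the potential infinite there. *)
Definition potential_kernel xi eta : \bar R := (((chord xi eta ^+ 2 / 2)%:E)^-1)%E.

Definition potential xi : \bar R := (\int[nu]_eta potential_kernel xi eta)%E.

Lemma chord_ge0 xi eta : 0 <= chord xi eta.
Proof. exact: normc_ge0. Qed.

Lemma chord_le2 xi eta : chord xi eta <= 2.
Proof. by rewrite (le_trans (normc_triangleB _ _))// !normc_circle. Qed.

Lemma chordC xi eta : chord xi eta = chord eta xi.
Proof. exact: normcBC. Qed.

Lemma chord_triangle zeta xi eta : chord xi eta <= chord xi zeta + chord zeta eta.
Proof. by rewrite /chord [leRHS]addrC normc_dist_triangle. Qed.

Lemma potential_kernel0 xi eta : chord xi eta = 0 -> potential_kernel xi eta = +oo%E.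
Proof. by move=> c0; rewrite /potential_kernel c0 expr0n mul0r inve0. Qed.

Lemma potential_kernelE xi eta : chord xi eta != 0 ->
  potential_kernel xi eta = (2 / chord xi eta ^+ 2)%:E.
Proof.
move=> c0; rewrite /potential_kernel inver mulf_eq0 sqrf_eq0 (negbTE c0) invr_eq0.
by rewrite pnatr_eq0/= invf_div.
Qed.

Lemma potential_kernel_ge0 xi eta : (0 <= potential_kernel xi eta)%E.
Proof. by rewrite /potential_kernel inve_ge0 lee_fin divr_ge0 ?sqr_ge0. Qed.

Lemma potential_kernel_lty xi eta : (potential_kernel xi eta < +oo)%E -> chord xi eta != 0.
Proof. by apply: contraTneq => /potential_kernel0 ->. Qed.

Lemma potential_kernel_ge xi eta (c : R) : chord xi eta <= c -> 0 < c ->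
  ((2 / c ^+ 2)%:E <= potential_kernel xi eta)%E.
Proof.
move=> ec c0; have [/eqP/potential_kernel0->|e0] := boolP (chord xi eta == 0).
  by rewrite leey.
rewrite potential_kernelE// lee_fin ler_pM2l// lef_pV2 ?posrE ?exprn_gt0//.
  by rewrite ler_pXn2r// nnegrE ?chord_ge0 ?ltW.
by rewrite lt_def e0 chord_ge0.
Qed.

Lemma measurable_inve_real d (T : measurableType d) (f : T -> R) :
  measurable_fun setT f -> (forall x, 0 <= f x) ->
  measurable_fun setT (fun x => ((f x)%:E^-1)%E).
Proof.
move=> mf f0.
have -> : (fun x => ((f x)%:E^-1)%E) = (fun x => if f x == 0 then +oo%E else (f x `^ (-1))%:E).
  by apply/funext => x; rewrite inver powR_inv1.
apply: measurable_fun_ifT => //; first exact: measurable_fun_eqr.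
by apply/measurable_EFinP; exact: measurableT_comp (measurable_powR _) mf.
Qed.

Lemma measurable_sqr_chord : measurable_fun setT
  (fun p : circle R * circle R => chord p.1 p.2 ^+ 2).
Proof.
have mc := complex_measurable_circle R.
apply: (measurable_sqr_normc (f := fun p : circle R * circle R => circle_val p.2 - circle_val p.1)).
case: mc => mr mi; apply: complex_measurableB; split.
- exact: measurableT_comp mr measurable_snd.
- exact: measurableT_comp mi measurable_snd.
- exact: measurableT_comp mr measurable_fst.
- exact: measurableT_comp mi measurable_fst.
Qed.

Lemma measurable_potential_kernel_pair : measurable_fun setT
  (fun p : circle R * circle R => potential_kernel p.1 p.2).
Proof.
apply: measurable_inve_real; last by move=> p; rewrite divr_ge0 ?sqr_ge0.
by apply: measurable_funM => //; exact: measurable_sqr_chord.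
Qed.

Lemma measurable_potential_kernel xi : measurable_fun setT (potential_kernel xi).
Proof. exact: measurableT_comp measurable_potential_kernel_pair (measurable_pair1 xi). Qed.

Lemma measurable_chord xi : measurable_fun setT (chord xi).
Proof.
have -> : chord xi = fun eta => (chord xi eta ^+ 2) `^ 2^-1.
  by apply/funext => eta; rewrite powR12_sqrt ?sqr_ge0// sqrtr_sqr ger0_norm ?chord_ge0.
apply: (measurableT_comp (measurable_powR _)).
exact: measurableT_comp measurable_sqr_chord (measurable_pair1 xi).
Qed.

End potential.

Section radial_identities.
Variable R : realType.
Implicit Types (xi eta : circle R) (r : R).

Lemma circle_valMconj xi :
  complex.Re (circle_val xi) ^+ 2 + complex.Im (circle_val xi) ^+ 2 = 1.
Proof. by rewrite -sqr_normc normc_circle expr1n. Qed.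

(** The law of cosines; it compares [|eta - r xi|] with both [1 - r] and
    [|eta - xi|]. *)
Lemma sqr_normc_radial xi eta r :
  normc (circle_val eta - r%:C * circle_val xi) ^+ 2 =
  (1 - r) ^+ 2 + r * chord xi eta ^+ 2.
Proof.
rewrite !sqr_normc !ReB !ImB ReM ImM /=.
have := circle_valMconj xi; have := circle_valMconj eta.
case: (circle_val xi) (circle_val eta) => a b [c d] /= h1 h2.
apply/eqP; rewrite -subr_eq0; apply/eqP; rewrite [LHS](_ : _ =
  (1 - r) * (c ^+ 2 + d ^+ 2 - 1) - r * (1 - r) * (a ^+ 2 + b ^+ 2 - 1)).
  by rewrite h1 h2 subrr !mulr0 subrr.
by ring.
Qed.

Lemma Re_herglotz_kernel xi eta r :
  complex.Re ((circle_val eta + r%:C * circle_val xi) /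
              (circle_val eta - r%:C * circle_val xi)) =
  (1 - r ^+ 2) / normc (circle_val eta - r%:C * circle_val xi) ^+ 2.
Proof.
rewrite ReM ReV ImV mulNr mulrN opprK !mulrA -mulrDl; congr (_ / _).
rewrite !ReB !ImB !ReD !ImD ReM ImM /=.
have := circle_valMconj xi; have := circle_valMconj eta.
case: (circle_val xi) (circle_val eta) => a b [c d] /= h1 h2.
rewrite [LHS](_ : _ = (c ^+ 2 + d ^+ 2) - r ^+ 2 * (a ^+ 2 + b ^+ 2)).
  by rewrite h1 h2 mulr1.
by ring.
Qed.

(** On the circle, [(eta - xi)^2 = - eta xi |eta - xi|^2]; hence the argument of
    this kernel does not depend on [eta], and its integral has modulus the integral
    of the modulus. *)
Lemma herglotz_deriv_kernel_circle xi eta :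
  2 * circle_val eta / (circle_val eta - circle_val xi) ^+ 2 =
  - (circle_val xi)^-1 * (2 / chord xi eta ^+ 2)%:C.
Proof.
have nz (z : circle R) : circle_val z != 0.
  by rewrite -normc_gt0 normc_circle.
have [ez|ez] := eqVneq (circle_val eta - circle_val xi) 0.
  by rewrite /chord ez Normc.normc0 expr0n/= !expr0n/= !invr0 !mulr0.
have -> : (2 / chord xi eta ^+ 2)%:C = 2 / (chord xi eta ^+ 2)%:C :> R[i].
  by rewrite rmorphM /= fmorphV /= rmorph_nat.
have key : (chord xi eta ^+ 2)%:C * (circle_val eta * circle_val xi) =
    - (circle_val eta - circle_val xi) ^+ 2 :> R[i].
  rewrite /chord rmorphXn /= -normrE_normc normCK rmorphB /=.
  have conjV (z : circle R) : circle_val z * (circle_val z)^* = 1.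
    by rewrite -normCK normrE_normc normc_circle expr1n.
  have h1 := conjV xi; have h2 := conjV eta.
  move: (circle_val xi) (circle_val eta) h1 h2 => x e.
  move: x^* e^* => x' e' h1 h2.
  have -> : (e - x) * (e' - x') * (e * x) = (e - x) * (e * e' * x - x * x' * e) by ring.
  by rewrite h1 h2; ring.
have c0 : (chord xi eta ^+ 2)%:C != 0 :> R[i].
  by rewrite fmorph_eq0 sqrf_eq0 normc_eq0.
have k0 : (circle_val eta - circle_val xi) ^+ 2 =
    - ((chord xi eta ^+ 2)%:C * (circle_val eta * circle_val xi)).
  by rewrite key opprK.
by rewrite k0; field; rewrite ?nz /= andbT fmorph_eq0 /chord normc_eq0.
Qed.

End radial_identities.

Section radial_limits.
Variable R : realType.

(** Restricting to sequences with values in [[1/2, 1[] keeps the radial kernels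
    dominated by their value on the circle. *)
Lemma cvg_at_left1P (f : R -> R) (l : R) :
  (forall u : R^nat, (forall n, 1 / 2 <= u n < 1) -> u n @[n --> \oo] --> (1 : R) ->
     f (u n) @[n --> \oo] --> l) ->
  f r @[r --> (1 : R)^'-] --> l.
Proof.
move=> fu; pose g r := f (Num.max (1 / 2) r).
have gl : g r @[r --> (1 : R)^'-] --> l.
  apply/cvg_at_leftP => u [u1 ucvg]; apply: fu.
    by move=> n; rewrite le_max lexx/= gt_max u1 andbT; lra.
  apply: cvg_trans (ucvg); apply: near_eq_cvg; near=> n.
  by apply/esym/max_idPr; near: n; apply: (cvgr_ge _ ucvg); lra.
apply: cvg_trans gl; apply: near_eq_cvg.
near=> r; rewrite /g; congr f; apply/max_idPr.
by near: r; apply: nbhs_left_ge; lra.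
Unshelve. all: by end_near. Qed.

Lemma complex_cvg_at_left1P (f : R -> R[i]^o) (l : R[i]^o) :
  (forall u : R^nat, (forall n, 1 / 2 <= u n < 1) -> u n @[n --> \oo] --> (1 : R) ->
     f (u n) @[n --> \oo] --> l) ->
  f r @[r --> (1 : R)^'-] --> l.
Proof.
move=> fu; apply/cvg_ReIm; split; apply: cvg_at_left1P => u u1 uc.
  by have /cvg_ReIm[] := fu u u1 uc.
by have /cvg_ReIm[] := fu u u1 uc.
Qed.

Lemma cvg_inve (u : R^nat) (l : R) : (forall n, 0 < u n) ->
  u n @[n --> \oo] --> l -> ((u n)%:E^-1)%E @[n --> \oo] --> (l%:E^-1)%E.
Proof.
move=> u0 ul.
have uE : (fun n => ((u n)%:E^-1)%E) = (fun n => ((u n)^-1)%:E).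
  by apply/funext => n; rewrite inver gt_eqF.
rewrite uE; have [l0|l0] := eqVneq l 0.
  by rewrite l0 inve0; apply/cvgeryP/cvgrVy; [exact: nearW|rewrite -l0].
by rewrite inver (negbTE l0); apply: cvg_EFin; [exact: nearW|exact: cvgV].
Qed.

End radial_limits.

Section angular_derivative_formula.
Variables (R : realType) (nu : {measure set (circle R) -> \bar R}).
Hypothesis nu_fin : (nu setT < +oo)%E.
Implicit Types (xi eta : circle R) (r : R).

Lemma normc_radial xi r : 0 <= r -> normc (r%:C * circle_val xi) = r.
Proof. by move=> r0; rewrite normcMr normc_circle mulr1 normc_real ger0_norm. Qed.

Lemma complex_integral_Re (f : circle R -> R[i]^o) :
  complex.Re (complex_integral nu f) = \int[nu]_x complex.Re (f x).
Proof. by []. Qed.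

(** Near the end of the radius [|H'| = |S'| / |S|] is bounded, while
    [Re H = - ln |S|] tends to [0]; the mean value theorem then makes [Re H]
    vanish at least linearly in [1 - r]. *)
Lemma radial_Re_herglotz_le xi :
  finite_angular_derivative (singular_inner nu) xi ->
  exists r0 M : R, [/\ 0 <= r0, r0 < 1 & forall r, r0 < r < 1 ->
    complex.Re (herglotz nu (r%:C * circle_val xi)) <= M * (1 - r)].
Proof.
move=> [[w w1 Sw] [l Sl]].
have w1' : normc w = 1 by move: w1; rewrite normrE_normc => -[].
have nS : (normc (singular_inner nu (r%:C * circle_val xi)) : R) @[r --> (1 : R)^'-]
    --> (normc w : R) by apply: cvg_normc; exact: Sw.
rewrite w1' in nS.
have nS' : (normc (derive1 (singular_inner nu) (r%:C * circle_val xi)) : R)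
    @[r --> (1 : R)^'-] --> (normc l : R) by apply: cvg_normc; exact: Sl.
pose A r := complex.Re (herglotz nu (r%:C * circle_val xi)).
have A0 : A r @[r --> (1 : R)^'-] --> 0.
  have -> : A = fun r => - ln (normc (singular_inner nu (r%:C * circle_val xi))).
    by apply/funext => r; rewrite normc_singular_inner expRK opprK.
  rewrite -oppr0 -(ln1 R); apply: cvgN.
  by apply: continuous_cvg nS; exact: continuous_ln.
pose M := 2 * (normc l + 1).
have near1 : \forall r \near (1 : R)^'-,
    normc (herglotz_deriv nu (r%:C * circle_val xi)) <= M.
  near=> r.
  have r0 : 0 <= r by near: r; apply: nbhs_left_ge.
  have r1 : r < 1 by near: r; exact: nbhs_left_lt.
  have a1 : 1 / 2 < normc (singular_inner nu (r%:C * circle_val xi)).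
    by near: r; apply: (cvgr_gt _ nS); lra.
  have a2 : normc (derive1 (singular_inner nu) (r%:C * circle_val xi)) < normc l + 1.
    by near: r; apply: (cvgr_lt _ nS'); rewrite ltrDl.
  move: a2; rewrite derive1_singular_inner ?normc_radial// normcNE normcMr => a2.
  have d0 := normc_ge0 (herglotz_deriv nu (r%:C * circle_val xi)).
  rewrite /M; nra.
move: near1; rewrite near_withinE => /nbhs_ballP[e /= e0 he].
pose r0 := Num.max 0 (1 - e).
exists r0, M; split.
- by rewrite le_max lexx.
- by rewrite gt_max ltr01/= gtrBl.
move=> r /andP[]; rewrite gt_max => /andP[r00 re] r1.
have D s : r <= s < 1 -> normc (herglotz_deriv nu (s%:C * circle_val xi)) <= M.
  move=> /andP[rs s1]; apply: he => //; rewrite /ball /= gtr0_norm ?subr_gt0//; lra.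
have step s : r < s < 1 -> A r - M * (1 - r) <= A s.
  move=> /andP[rs s1].
  have dA t : r <= t <= s -> is_derive t 1 A
      (complex.Re (circle_val xi * herglotz_deriv nu (t%:C * circle_val xi))).
    move=> /andP[rt ts].
    apply: (@complex_derivative_Re R _ _
      (fun t => herglotz_deriv nu (t%:C * circle_val xi))).
      exact: normc_circle.
    by apply: herglotz_derivative => //; rewrite normc_radial; lra.
  have cA : {within `[r, s], continuous A}.
    by apply: derivable_within_continuous => t; rewrite in_itv/= => /dA[].
  have dA' t : t \in `]r, s[ -> is_derive t 1 A
      (complex.Re (circle_val xi * herglotz_deriv nu (t%:C * circle_val xi))).
    by rewrite in_itv/= => /andP[rt ts]; apply: dA; rewrite !ltW.
  have [c] := MVT rs dA' cA.
  rewrite in_itv/= => /andP[rc cs] E.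
  have : `|complex.Re (circle_val xi * herglotz_deriv nu (c%:C * circle_val xi))| <= M.
    rewrite (le_trans (Re_le_normc _))// normcMr normc_circle mul1r D//.
    by rewrite (ltW rc) (lt_trans cs).
  rewrite ler_norml => /andP[+ _].
  move: (complex.Re _) E => y E yM.
  have : - M * (s - r) <= y * (s - r) by rewrite ler_wpM2r// subr_ge0 ltW.
  have M0 : 0 <= M by rewrite /M mulr_ge0// addr_ge0// normc_ge0.
  have : M * (s - r) <= M * (1 - r) by rewrite ler_wpM2l// lerB// ltW.
  lra.
rewrite -subr_le0; apply: (cvgr_to_ge A0); near=> s; apply: step.
apply/andP; split; near: s; [exact: nbhs_left_gt|exact: nbhs_left_lt].
Unshelve. all: by end_near. Qed.

End angular_derivative_formula.

Section angular_derivative_potential.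
Variables (R : realType) (nu : {measure set (circle R) -> \bar R}).
Hypothesis nu_fin : (nu setT < +oo)%E.
Implicit Types (xi eta : circle R) (r : R).

Lemma cvg_sqr_normc_radial xi eta (u : R^nat) : u n @[n --> \oo] --> (1 : R) ->
  normc (circle_val eta - (u n)%:C * circle_val xi) ^+ 2 @[n --> \oo] -->
  chord xi eta ^+ 2.
Proof.
move=> u1; under eq_cvg do rewrite sqr_normc_radial.
suff : (1 - u n) ^+ 2 + u n * chord xi eta ^+ 2 @[n --> \oo] -->
    ((1 - 1) ^+ 2 + 1 * chord xi eta ^+ 2 : R) by rewrite subrr expr0n add0r mul1r.
have u1' : 1 - u n @[n --> \oo] --> (1 - 1 : R) by apply: cvgB => //; exact: cvg_cst.
apply: cvgD; first exact: (cvgM u1' u1').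
exact: (cvgM u1 (cvg_cst _)).
Qed.

Lemma normc_radial_gt0 xi eta r : 0 <= r < 1 ->
  0 < normc (circle_val eta - r%:C * circle_val xi).
Proof.
move=> /andP[r0 r1]; apply: lt_le_trans (normc_circleB_ge _ _).
by rewrite normc_radial// subr_gt0.
Qed.

(** The real part of the Herglotz kernel is the Poisson kernel.  Divided by
    [1 - r] it is written as an inverse, to match the kernel of the potential. *)
Lemma integral_Poisson xi r : 0 <= r < 1 ->
  (\int[nu]_eta
     ((normc (circle_val eta - r%:C * circle_val xi) ^+ 2 / (1 + r))%:E^-1) =
   (complex.Re (herglotz nu (r%:C * circle_val xi)) / (1 - r))%:E)%E.
Proof.
move=> r01; have /andP[r0 r1] := r01.
have z1 : normc (r%:C * circle_val xi) < 1 by rewrite normc_radial.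
have [ir _] := herglotz_integrable nu_fin z1.
have -> : complex.Re (herglotz nu (r%:C * circle_val xi)) / (1 - r) =
    \int[nu]_eta ((1 - r)^-1 * complex.Re
      ((circle_val eta + r%:C * circle_val xi) / (circle_val eta - r%:C * circle_val xi))).
  by rewrite RintegralZl// mulrC.
rewrite /Rintegral fineK; last first.
  exact: (integrable_fin_num measurableT (integrableZl measurableT (1 - r)^-1 ir)).
apply: eq_integral => eta _; rewrite Re_herglotz_kernel inver.
have n0 := normc_radial_gt0 xi eta r01.
rewrite gt_eqF ?divr_gt0 ?exprn_gt0//; last by rewrite ltr_wpDr.
congr EFin; field; rewrite ?gt_eqF ?subr_gt0//=.
by rewrite ltr_wpDr.
Qed.

(** Fatou's lemma along a sequence of radii: the Poisson integrals divided by
    [1 - r] stay bounded, and their integrands converge to the kernel of the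
    potential. *)
Lemma finite_angular_derivative_potential_lty xi :
  finite_angular_derivative (singular_inner nu) xi ->
  (potential nu xi < +oo)%E.
Proof.
move=> /(radial_Re_herglotz_le nu_fin)[r0 [M [r00 r01 hM]]].
(* A sequence of radii lying in ]r0, 1[ from its first term on. *)
pose u (n : nat) : R := 1 - (1 - r0) * (n.+2%:R^-1).
have ub n : r0 < u n < 1.
  rewrite /u ltrBrDr -ltrBrDl gtrBl; apply/andP; split.
    by rewrite gtr_pMr ?subr_gt0// invf_lt1// ltr1n.
  by rewrite mulr_gt0 ?subr_gt0// invr_gt0.
have u01 n : 0 <= u n < 1.
  by have /andP[h1 ->] := ub n; rewrite (le_trans r00)// ltW.
have ucvg : u n @[n --> \oo] --> (1 : R).
  suff : u n @[n --> \oo] --> (1 - (1 - r0) * 0 : R) by rewrite mulr0 subr0.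
  apply: cvgB; first exact: cvg_cst.
  apply: cvgM; first exact: cvg_cst.
  by rewrite (cvg_shiftS (fun n => n.+1%:R^-1 : R)); exact: cvg_harmonic.
pose f n eta := (normc (circle_val eta - (u n)%:C * circle_val xi) ^+ 2 / (1 + u n))%:E^-1%E.
have f_ge0 n eta : (0 <= f n eta)%E.
  rewrite /f inve_ge0 lee_fin divr_ge0 ?sqr_ge0// addr_ge0//.
  by have /andP[] := u01 n.
have mf n : measurable_fun setT (f n).
  apply: measurable_inve_real.
    apply: measurable_funM => //; apply: measurable_sqr_normc.
    apply: complex_measurableB; first exact: complex_measurable_circle.
    exact: complex_measurable_cst.
  move=> eta; rewrite divr_ge0 ?sqr_ge0// addr_ge0//.
  by have /andP[] := u01 n.
have fcvg eta : f n eta @[n --> \oo] --> potential_kernel xi eta.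
  apply: cvg_inve.
    move=> n; rewrite divr_gt0 ?exprn_gt0 ?normc_radial_gt0//.
    by have /andP[? _] := u01 n; rewrite ltr_wpDr.
  apply: cvgM; first exact: cvg_sqr_normc_radial.
  apply: cvgV; first by [].
  by apply: cvgD => //; exact: cvg_cst.
have := fatou nu measurableT mf (fun n eta _ => f_ge0 n eta).
under eq_integral do rewrite (cvg_limn_einf_sup (fcvg _)).1.
move=> /le_lt_trans; apply.
apply: (@le_lt_trans _ _ M%:E); last exact: ltry.
rewrite limn_einf_lim; apply: lime_le; first exact: is_cvg_einfs.
apply: nearW => n; apply: (@le_trans _ _ (\int[nu]_eta f n eta)%E).
  by apply: ereal_inf_lbound; exists n => /=.
rewrite integral_Poisson// lee_fin; have /andP[? un1] := ub n.
by rewrite ler_pdivrMr ?subr_gt0// hM// ub.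
Qed.

Section finite_potential.
Variable xi : circle R.
Hypothesis pot_fin : (potential nu xi < +oo)%E.

Let g eta : \bar R := (4%:E * potential_kernel xi eta)%E.

Lemma potential_kernel_integrable : nu.-integrable setT (potential_kernel xi).
Proof.
apply/integrableP; split; first exact: measurable_potential_kernel.
by under eq_integral do rewrite gee0_abs ?potential_kernel_ge0//.
Qed.

(** By the law of cosines [|eta - r xi|^2 >= r |eta - xi|^2 >= |eta - xi|^2 / 2]. *)
Lemma radial_inv_le eta r : 1 / 2 <= r < 1 ->
  (((normc (circle_val eta - r%:C * circle_val xi) ^+ 2)^-1)%:E <=
    potential_kernel xi eta)%E.
Proof.
move=> /andP[r2 r1]; have r0 : 0 <= r < 1 by rewrite r1 andbT; lra.
have [/eqP/potential_kernel0->|c0] := boolP (chord xi eta == 0).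
  by rewrite leey.
have cp : 0 < chord xi eta ^+ 2 by rewrite exprn_even_gt0.
have n0 := normc_radial_gt0 xi eta r0.
rewrite potential_kernelE// lee_fin -[2 / _]invf_div lef_pV2 ?posrE ?divr_gt0 ?(exprn_gt0 _ n0)//.
rewrite sqr_normc_radial.
have : 1 / 2 * chord xi eta ^+ 2 <= r * chord xi eta ^+ 2 by rewrite ler_wpM2r// ltW.
have := sqr_ge0 (1 - r); lra.
Qed.

Lemma cvg_radial (u : R^nat) : u n @[n --> \oo] --> (1 : R) ->
  ((u n)%:C * circle_val xi : R[i]^o) @[n --> \oo] --> circle_val xi.
Proof.
move=> u1; have uC : ((u n)%:C : R[i]^o) @[n --> \oo] --> (1 : R[i]^o).
  by apply/cvg_ReIm; split; [exact: u1|exact: cvg_cst].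
rewrite -[circle_val xi]mul1r; apply: complex_cvgM uC _.
by rewrite mul1r; exact: cvg_cst.
Qed.

Lemma radial_herglotz_cvg :
  (herglotz nu (r%:C * circle_val xi) : R[i]^o) @[r --> (1 : R)^'-] -->
  (herglotz nu (circle_val xi) : R[i]^o).
Proof.
apply: complex_cvg_at_left1P => u u1 uc.
apply: (complex_integral_dominated_cvg (g := g)).
- by move=> n; exact: complex_measurable_herglotz.
- exact: complex_measurable_herglotz.
- by apply: integrableZl => //; exact: potential_kernel_integrable.
- move=> n eta; rewrite /g.
  have u0 : 0 <= u n < 1 by have /andP[? ->] := u1 n; rewrite andbT; lra.
  have n0 := normc_radial_gt0 xi eta u0.
  apply: le_trans (lee_wpmul2l _ (radial_inv_le eta (u1 n))) => //.
  rewrite -EFinM lee_fin normcMr normcVr.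
  have /andP[u00 u11] := u0.
  (* As [|eta - r xi| <= 2], a factor of it may be added to the denominator. *)
  have b1 : normc (circle_val eta + (u n)%:C * circle_val xi) <= 2.
    by rewrite (le_trans (normc_triangle _ _))// normc_radial// normc_circle; lra.
  have b2 : normc (circle_val eta - (u n)%:C * circle_val xi) <= 2.
    by rewrite (le_trans (normc_triangleB _ _))// normc_radial// normc_circle; lra.
  rewrite ler_pdivlMr ?exprn_gt0// expr2 mulrA mulfVK ?gt_eqF//.
  by rewrite (_ : 4 = 2 * 2) ?ler_pM ?normc_ge0//; ring.
- move=> eta; rewrite /g => gy.
  have c0 : circle_val eta - circle_val xi != 0.
    rewrite -normc_eq0; apply: potential_kernel_lty; apply: contraTT gy.
    by rewrite -leNgt leye_eq => /eqP ->; rewrite gt0_muley.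
  have cx := cvg_radial uc.
  have ce : (circle_val eta : R[i]^o) @[_ --> \oo] --> (circle_val eta : R[i]^o).
    exact: cvg_cst.
  exact: (complex_cvgM (complex_cvgD ce cx) (complex_cvgV c0 (complex_cvgB ce cx))).
Qed.

Lemma radial_herglotz_deriv_cvg :
  (herglotz_deriv nu (r%:C * circle_val xi) : R[i]^o) @[r --> (1 : R)^'-] -->
  (herglotz_deriv nu (circle_val xi) : R[i]^o).
Proof.
apply: complex_cvg_at_left1P => u u1 uc.
apply: (complex_integral_dominated_cvg (g := g)).
- by move=> n; exact: complex_measurable_herglotz_deriv.
- exact: complex_measurable_herglotz_deriv.
- by apply: integrableZl => //; exact: potential_kernel_integrable.
- move=> n eta; rewrite /g.
  have u0 : 0 <= u n < 1 by have /andP[? ->] := u1 n; rewrite andbT; lra.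
  have n0 := normc_radial_gt0 xi eta u0.
  apply: le_trans (lee_wpmul2l _ (radial_inv_le eta (u1 n))) => //.
  rewrite -EFinM lee_fin !normcMr normc2 normc_circle mulr1 normcVr normcXr.
  by rewrite ler_wpM2r ?invr_ge0 ?sqr_ge0//; lra.
- move=> eta; rewrite /g => gy.
  have c0 : circle_val eta - circle_val xi != 0.
    rewrite -normc_eq0; apply: potential_kernel_lty; apply: contraTT gy.
    by rewrite -leNgt leye_eq => /eqP ->; rewrite gt0_muley.
  have cx := cvg_radial uc.
  have ce (z : R[i]^o) : z @[_ --> \oo] --> z by exact: cvg_cst.
  have cB : (circle_val eta - (u n)%:C * circle_val xi : R[i]^o) @[n --> \oo] -->
    (circle_val eta - circle_val xi : R[i]^o) by exact: (complex_cvgB (ce _) cx).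
  have cB2 : ((circle_val eta - (u n)%:C * circle_val xi) ^+ 2 : R[i]^o) @[n --> \oo] -->
    ((circle_val eta - circle_val xi) ^+ 2 : R[i]^o) by exact: (complex_cvgM cB cB).
  have c20 : (circle_val eta - circle_val xi) ^+ 2 != 0 by rewrite expf_neq0.
  exact: (complex_cvgM (ce (2 * circle_val eta)) (complex_cvgV c20 cB2)).
Qed.

Lemma Re_herglotz_circle : complex.Re (herglotz nu (circle_val xi)) = 0.
Proof.
rewrite /herglotz complex_integral_Re.
under eq_Rintegral => eta _.
  have := Re_herglotz_kernel xi eta 1.
  rewrite rmorph1 mul1r expr1n subrr mul0r => ->.
  over.
by rewrite Rintegral_cst// mul0r.
Qed.

Lemma normc_herglotz_deriv_circle :
  ((normc (herglotz_deriv nu (circle_val xi)))%:E = potential nu xi)%E.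
Proof.
rewrite /herglotz_deriv.
under [X in complex_integral _ X]eq_fun do rewrite herglotz_deriv_kernel_circle.
have iK := potential_kernel_integrable.
pose k eta : R := 2 / chord xi eta ^+ 2.
have kE eta : k eta = fine (potential_kernel xi eta).
  have [/eqP c0|c0] := boolP (chord xi eta == 0).
    by rewrite /k potential_kernel0// c0 expr0n invr0 mulr0.
  by rewrite potential_kernelE.
have mk : measurable_fun setT k.
  rewrite (_ : k = fine \o potential_kernel xi); last by apply/funext.
  by apply: measurableT_comp => //; exact: measurable_potential_kernel.
have kK : (\int[nu]_eta (k eta)%:E = potential nu xi)%E.
  apply: ae_eq_integral => //.
  - exact/measurable_EFinP.
  - exact: measurable_potential_kernel.
  have := integrable_ae measurableT iK.
  by apply: filterS => eta /= H _; rewrite kE fineK// H.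
have ik : nu.-integrable setT (EFin \o k).
  apply/integrableP; split; first exact/measurable_EFinP.
  under eq_integral => eta _.
    by rewrite gee0_abs ?lee_fin ?divr_ge0 ?sqr_ge0//; over.
  by rewrite kK.
have ick : complex_integrable nu (fun eta => (k eta)%:C).
  by split => //=; apply: (eq_integrable measurableT (cst 0%E)) => //; exact: integrable0.
rewrite complex_integralZ// normcMr normcNE normcVr normc_circle invr1 mul1r.
have -> : complex_integral nu (fun eta => (k eta)%:C) = (\int[nu]_eta k eta)%:C.
  by rewrite /complex_integral /= Rintegral_cst// mul0r.
rewrite normc_real ger0_norm; last by apply: Rintegral_ge0 => eta _; rewrite divr_ge0 ?sqr_ge0.
by rewrite /Rintegral fineK ?kK// -kK integrable_fin_num.
Qed.

Lemma normc_singular_inner_circle : normc (singular_inner nu (circle_val xi)) = 1.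
Proof. by rewrite normc_singular_inner Re_herglotz_circle oppr0 expR0. Qed.

Lemma radial_singular_inner_cvg :
  (singular_inner nu (r%:C * circle_val xi) : R[i]^o) @[r --> (1 : R)^'-] -->
  (singular_inner nu (circle_val xi) : R[i]^o).
Proof. by apply: cvg_cexp; apply: complex_cvgN; exact: radial_herglotz_cvg. Qed.

Lemma radial_derive1_singular_inner_cvg :
  (derive1 (singular_inner nu) (r%:C * circle_val xi) : R[i]^o) @[r --> (1 : R)^'-] -->
  (- (herglotz_deriv nu (circle_val xi) * singular_inner nu (circle_val xi)) : R[i]^o).
Proof.
have cl : (- (herglotz_deriv nu (r%:C * circle_val xi) *
      singular_inner nu (r%:C * circle_val xi)) : R[i]^o) @[r --> (1 : R)^'-] -->
    (- (herglotz_deriv nu (circle_val xi) * singular_inner nu (circle_val xi)) : R[i]^o).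
  apply: complex_cvgN; apply: complex_cvgM; first exact: radial_herglotz_deriv_cvg.
  exact: radial_singular_inner_cvg.
apply: cvg_trans cl; apply: near_eq_cvg; near=> r.
rewrite derive1_singular_inner// normc_radial.
  by near: r; exact: nbhs_left_lt.
by near: r; apply: nbhs_left_ge.
Unshelve. all: by end_near. Qed.

End finite_potential.

(** Where the potential is finite, [S_nu] has a unimodular radial limit and
    [|S_nu'| = |H'|] is the potential; elsewhere the angular derivative cannot be
    finite.  The formula holds at every point, which also gives the measurability
    of the angular derivative. *)
Lemma abs_angular_derivative_potential xi :
  abs_angular_derivative (singular_inner nu) xi = potential nu xi.
Proof.
rewrite /abs_angular_derivative; case: asboolP => h.
  have pfin := finite_angular_derivative_potential_lty h.
  rewrite -normc_herglotz_deriv_circle//; congr EFin; apply: cvg_lim => //.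
  have : (normc (derive1 (singular_inner nu) (r%:C * circle_val xi)) : R)
      @[r --> (1 : R)^'-] -->
      (normc (- (herglotz_deriv nu (circle_val xi) * singular_inner nu (circle_val xi))) : R).
    by apply: cvg_normc; exact: radial_derive1_singular_inner_cvg.
  by rewrite normcNE normcMr normc_singular_inner_circle// mulr1.
have [pfin|] := ltP (potential nu xi) +oo%E; last by rewrite leye_eq => /eqP.
exfalso; apply: h; split.
  exists (singular_inner nu (circle_val xi)).
    by rewrite normrE_normc normc_singular_inner_circle.
  exact: radial_singular_inner_cvg.
by eexists; exact: radial_derive1_singular_inner_cvg.
Qed.

End angular_derivative_potential.

Section potential_bounds.
Variables (R : realType) (nu : {measure set (circle R) -> \bar R}).
Implicit Types (xi eta : circle R) (c d : R).
Local Open Scope ereal_scope.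

Lemma potential_ge_near xi c (B : set (circle R)) : measurable B -> (0 < c)%R ->
  (forall eta, B eta -> (chord xi eta <= c)%R) ->
  (2 / c ^+ 2)%:E * nu B <= potential nu xi.
Proof.
move=> mB c0 Bc; rewrite -(integral_cst nu mB).
apply: (@le_trans _ _ (\int[nu]_(eta in B) potential_kernel xi eta)).
  apply: ge0_le_integral => //.
  - by move=> eta _; rewrite lee_fin divr_ge0 ?sqr_ge0.
  - by apply: measurable_funTS; exact: measurable_potential_kernel.
  - by move=> eta /Bc Beta; exact: potential_kernel_ge.
apply: ge0_subset_integral => //; first exact: measurable_potential_kernel.
by move=> eta _; exact: potential_kernel_ge0.
Qed.

Lemma potential_le_far xi d (E : set (circle R)) : measurable E -> (0 < d)%R ->
  nu (~` E) = 0 -> (forall eta, E eta -> (d <= chord xi eta)%R) ->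
  potential nu xi <= (2 / d ^+ 2)%:E * nu setT.
Proof.
move=> mE d0 nuE Ed; rewrite -(integral_cst nu measurableT).
apply: ae_ge0_le_integral => //.
- by move=> eta _; exact: potential_kernel_ge0.
- exact: measurable_potential_kernel.
- by move=> eta _; rewrite lee_fin divr_ge0 ?sqr_ge0.
exists (~` E); split => //; first exact: measurableC.
apply: subsetC => eta Eeta /= _.
have cd := Ed _ Eeta; have c0 := lt_le_trans d0 cd.
rewrite potential_kernelE ?gt_eqF// lee_fin ler_pM2l// lef_pV2 ?posrE ?exprn_gt0//.
by rewrite ler_pXn2r// nnegrE ltW.
Qed.

End potential_bounds.

Section potential_measurable.
Variables (R : realType) (nu : {finite_measure set (circle R) -> \bar R}).

Lemma measurable_potential : measurable_fun setT (potential nu).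
Proof.
apply: (measurable_fun_fubini_tonelli_F (m2 := nu)
  (fun p : circle R * circle R => potential_kernel p.1 p.2)).
  exact: measurable_potential_kernel_pair.
by move=> p; exact: potential_kernel_ge0.
Qed.

End potential_measurable.

(** * Distance to a set *)

Section distance.
Variables (R : realType) (E : set (circle R)).
Implicit Types xi eta : circle R.

Lemma circle_dist_le xi eta : E eta -> (circle_dist xi E <= (chord xi eta)%:E)%E.
Proof. by move=> Ee; apply: ereal_inf_lbound; exists eta => //; rewrite chordC. Qed.

Lemma circle_dist_lt xi (c : \bar R) : (circle_dist xi E < c)%E ->
  exists2 eta, E eta & ((chord xi eta)%:E < c)%E.
Proof.
move=> /ereal_inf_lt[_ [eta Ee <-] h]; exists eta => //.
by rewrite chordC.
Qed.

Lemma circle_dist_ge0 xi : (0 <= circle_dist xi E)%E.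
Proof. by apply: le_ereal_inf_tmp => _ [eta _ <-]; rewrite lee_fin normc_ge0. Qed.

Lemma circle_dist_fin xi : E !=set0 ->
  exists d : R, [/\ circle_dist xi E = d%:E, 0 <= d & d <= 2].
Proof.
move=> [eta Ee]; have := circle_dist_ge0 xi.
have : (circle_dist xi E <= 2%:E)%E.
  by rewrite (le_trans (circle_dist_le _ Ee))// lee_fin chord_le2.
by case: (circle_dist xi E) => // d; rewrite !lee_fin => ? ?; exists d.
Qed.

Lemma open_chord_lt eta (c : R) : open [set xi | chord xi eta < c].
Proof.
have -> : [set xi | chord xi eta < c] = chord eta @^-1` [set x | x < c].
  by apply/seteqP; split => xi /=; rewrite chordC.
apply: open_comp; last exact: open_lt.
move=> xi _; apply: cvg_normc; first exact: nbhs_filter.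
apply: cvgB; [exact: nbhs_filter|exact: continuous_circle_val|].
by apply: cvg_cst; exact: nbhs_filter.
Qed.

Lemma measurable_circle_dist : measurable_fun setT (fun xi => circle_dist xi E).
Proof.
apply: (measurability _ (ErealGenInftyO.measurableE R)).
move=> _ [_ [c ->] <-]; rewrite setTI; apply: sub_sigma_algebra.
have -> : (fun xi => circle_dist xi E) @^-1` [set` `]-oo, c%:E[] =
    \bigcup_(eta in E) [set xi | chord xi eta < c].
  apply/seteqP; split => xi /=.
    rewrite in_itv/= => /circle_dist_lt[eta Ee]; rewrite lte_fin => h.
    by exists eta.
  move=> [eta Ee /= h]; rewrite in_itv/=.
  by rewrite (le_lt_trans (circle_dist_le _ Ee)).
by apply: bigcup_open => eta _; exact: open_chord_lt.
Qed.

End distance.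

(** * Powers of logarithms *)

Section log_integrability.
Variable R : realType.
Local Open Scope ereal_scope.

Lemma measurable_lne : measurable_fun setT (@lne R).
Proof.
apply: (measurability _ (ErealGenOInfty.measurableE R)).
move=> _ [_ [r ->] <-]; rewrite setTI.
have -> : @lne R @^-1` [set` `]r%:E, +oo[] = [set` `](expR r)%:E, +oo[].
  apply/seteqP; split => -[x| |] /=; rewrite !in_itv/= ?andbT ?ltry ?ltNge ?leNye//.
    case: ifPn => x0; first by rewrite leNye.
    rewrite -!ltNge !lte_fin -{1}[r]expRK ltr_ln ?posrE ?expR_gt0//.
    by rewrite ltNge.
  rewrite -!ltNge lte_fin => rx; have x0 : (0 < x)%R by rewrite (lt_trans _ rx)// expR_gt0.
  by rewrite leNgt x0/= lte_fin -{1}[r]expRK ltr_ln ?posrE ?expR_gt0.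
exact: emeasurable_itv.
Qed.

Lemma poweR_le_affine (p C : R) (x y : \bar R) : (0 < p)%R -> (0 <= C)%R ->
  0 <= x -> 0 <= y -> x <= C%:E + 2%:E * y ->
  x `^ p <= ((2 * C) `^ p)%:E + (4 `^ p)%:E * y `^ p.
Proof.
move=> p0 C0 x0 y0 xCy.
have mono (a b : \bar R) : 0 <= a -> a <= b -> a `^ p <= b `^ p.
  move=> a0 ab; apply: gt0_ler_poweR; rewrite ?in_itv/= ?leey ?andbT//.
  - exact: ltW.
  - exact: le_trans ab.
have [yC|Cy] := leP (2%:E * y) C%:E.
  apply: (@le_trans _ _ ((2 * C)%:E `^ p)).
    by apply: mono => //; rewrite (le_trans xCy)// (_ : (2 * C = C + C)%R) ?EFinD ?leeD2l//; ring.
  by rewrite poweR_EFin leeDl// mule_ge0 ?poweR_ge0// lee_fin powR_ge0.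
(* Here [C] is absorbed into [2 y], so that the whole bound is at most [4 y]. *)
apply: (@le_trans _ _ ((4%:E * y) `^ p)).
  apply: mono => //; rewrite (le_trans xCy)//.
  rewrite (_ : 4%:E = 2%:E + 2%:E :> \bar R); last by rewrite -EFinD; congr EFin; ring.
  by rewrite ge0_muleDl// leeD2r// ltW.
by rewrite poweRM// poweR_EFin leeDr// lee_fin powR_ge0.
Qed.

(** Bounding by an affine function preserves [p]-integrability because the
    measure is finite; no triangle inequality is used, so [p < 1] is allowed. *)
Lemma integral_poweR_lty d (T : measurableType d) (P : probability T R)
    (p C : R) (f g : T -> \bar R) : (0 < p)%R -> (0 <= C)%R ->
  measurable_fun setT f -> measurable_fun setT g ->
  (forall x, `|f x| <= C%:E + 2%:E * `|g x|) ->
  \int[P]_x (`|g x| `^ p) < +oo ->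
  \int[P]_x (`|f x| `^ p) < +oo.
Proof.
move=> p0 C0 mf mg fg gfin.
have mL (h : T -> \bar R) : measurable_fun setT h ->
    measurable_fun setT (fun x => `|h x| `^ p).
  move=> mh; apply: (measurableT_comp (measurable_poweR p)).
  exact: measurableT_comp.
have := @ge0_le_integral _ _ _ P setT measurableT (fun x => `|f x| `^ p)
  (fun x => ((2 * C) `^ p)%:E + (4 `^ p)%:E * `|g x| `^ p).
move=> /(_ _ (mL _ mf)) H; apply: le_lt_trans (H _ _ _) _.
- by move=> x _; exact: poweR_ge0.
- apply: emeasurable_funD => //; apply: measurable_funeM; exact: mL.
- by move=> x _; apply: poweR_le_affine.
rewrite ge0_integralD//; last 3 first.
- by move=> x _; rewrite lee_fin powR_ge0.
- by move=> x _; rewrite mule_ge0 ?poweR_ge0// lee_fin powR_ge0.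
- by apply: measurable_funeM; exact: mL.
rewrite integral_cst// ge0_integralZl//; last 2 first.
- exact: mL.
- by move=> x _; exact: poweR_ge0.
apply: lte_add_pinfty.
  by have := probability_setT P => /= ->; rewrite mule1 ltry.
by rewrite lte_mul_pinfty// ?lee_fin ?powR_ge0.
Qed.

Lemma Lnorm_lty d (T : measurableType d) (P : {measure set T -> \bar R}) (p : R)
    (f : T -> \bar R) : (0 < p)%R ->
  ('N[P]_(p%:E)[f] < +oo) <-> (\int[P]_x (`|f x| `^ p) < +oo).
Proof.
move=> p0; rewrite unlock /=; split.
  by apply: lty_poweRy; rewrite invr_neq0// gt_eqF.
exact: poweR_lty.
Qed.

(** At [d = 0] the right-hand side is [+oo], hence no upper bound on [u] is
    needed there. *)
Lemma abs_lne_le_of_bounds (u : \bar R) (d a b : R) :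
  (0 < a)%R -> (0 <= d)%R -> a%:E <= u ->
  ((0 < d)%R -> u <= (b / d ^+ 2)%:E) ->
  `|lne u| <= (`|ln a| + `|ln b|)%:E + 2%:E * `|lne d%:E|.
Proof.
move=> a0; rewrite le_eqVlt => /predU1P[<- _ _|d0 au].
  by rewrite /lne lexx /= gt0_muley ?lte_fin// addey ?leey.
move=> /(_ d0); case: u au => // u; rewrite !lee_fin => au ub.
have u0 : (0 < u)%R by exact: lt_le_trans au.
rewrite !lne_EFin//= lee_fin.
have b0 : (0 < b)%R.
  by have := lt_le_trans u0 ub; rewrite pmulr_lgt0// invr_gt0 exprn_gt0.
have h1 : (ln a <= ln u)%R by rewrite ler_ln.
have h2 : (ln u <= ln b - 2 * ln d)%R.
  rewrite (le_trans (y := ln (b / d ^+ 2)))//.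
    by rewrite ler_ln ?posrE// divr_gt0// exprn_gt0.
  by rewrite ln_div ?posrE ?exprn_gt0// lnXn// mulr_natl.
have := ler_norm (ln b); have := ler_norm (- ln d); rewrite normrN.
have := ler_norm (- ln a); rewrite normrN.
have := normr_ge0 (ln d); have := normr_ge0 (ln b); have := normr_ge0 (ln a).
rewrite ler_norml => *; apply/andP; split; lra.
Qed.

(** Converse comparison: [d] may be small only if [u] is large. *)
Lemma abs_lne_dist_le (u : \bar R) (d K : R) :
  (0 <= d <= 2)%R -> (0 < K)%R -> 0 <= u ->
  (d = 0%R -> u = +oo) -> ((0 < d)%R -> u \is a fin_num -> (1 <= K * d * fine u ^+ 2)%R) ->
  `|lne d%:E| <= (ln 2 + `|ln K|)%:E + 2%:E * `|lne u|.
Proof.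
move=> /andP[]; rewrite le_eqVlt => /predU1P[<-|d0] d2 K0 u0 h0 hd.
  by rewrite (h0 erefl) /= gt0_muley ?lte_fin// addey ?leey.
case: u u0 {h0} hd => [u u0 /(_ d0 isT) h|_ _|//]; last first.
  by rewrite /= gt0_muley ?lte_fin// addey ?leey.
rewrite lee_fin in u0.
have u1 : (0 < u)%R.
  rewrite lt_neqAle u0 andbT; apply: contraTneq h => /= <-.
  by rewrite expr0n mulr0 ler10.
rewrite !lne_EFin//= lee_fin.
have h1 : (ln d <= ln 2)%R by rewrite ler_ln ?posrE.
have h2 : (0 <= ln K + ln d + 2 * ln u)%R.
  rewrite -(ln1 R) (mulr_natl _ 2) -lnXn// -!lnM ?posrE ?mulr_gt0 ?exprn_gt0//.
  by rewrite ler_ln ?posrE// !mulr_gt0 ?exprn_gt0.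
have := ler_norm (ln K); have := ler_norm (ln u).
have := normr_ge0 (ln K); have := normr_ge0 (ln u).
have : (0 <= ln 2 :> R)%R by rewrite ln_ge0// ler1n.
rewrite ler_norml => *; apply/andP; split; lra.
Qed.

End log_integrability.

(** * Inner regularity *)

Section regularity.
Variables (R : realType) (nu : {measure set (circle R) -> \bar R}).
Hypothesis nu_fin : (nu setT < +oo)%E.
Implicit Types (A F U O : set (circle R)).

Lemma open_circle_measurable U : open U -> measurable U.
Proof. by move=> oU; exact: sub_sigma_algebra. Qed.

Lemma closed_circle_measurable F : closed F -> measurable F.
Proof.
move=> cF; rewrite -[F]setCK; apply: measurableC.
by apply: open_circle_measurable; exact: closed_openC.
Qed.

Lemma open_circle_ball O xi : open O -> O xi ->
  exists2 r : R, 0 < r & forall eta, chord xi eta < r -> O eta.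
Proof.
move=> [V oV <-] Vxi.
have /nbhs_ballP[[e e'] /= e0 he] : nbhs (circle_val xi) V.
  by rewrite nbhsE; exists V.
move: e0 he; rewrite ltcE /= => /andP[/eqP -> e0] he; exists e => // eta h.
apply: he; rewrite /ball /= -[e +i* 0]/(e%:C) normrE_normc ltcR.
by rewrite normcBC.
Qed.

Let measure_lty A : measurable A -> (nu A < +oo)%E.
Proof. by move=> mA; apply: le_lt_trans nu_fin; apply: le_measure; rewrite ?inE. Qed.

Lemma measure_nonincreasing_lt (B : (set (circle R))^nat) (X : set (circle R)) (e : R) :
  (forall n, measurable (B n)) -> nonincreasing_seq B -> measurable X ->
  \bigcap_n B n `<=` X -> 0 < e ->
  exists n, (nu (B n) < nu X + e%:E)%E.
Proof.
move=> mB dB mX BX e0.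
have mI : measurable (\bigcap_n B n) by exact: bigcapT_measurable.
have cB := nonincreasing_cvg_mu (measure_lty (mB 0%N)) mB mI dB.
have lt : (nu (\bigcap_n B n) < nu X + e%:E)%E.
  have : (nu (\bigcap_n B n) <= nu X)%E by apply: le_measure; rewrite ?inE.
  move=> /le_lt_trans; apply; rewrite lteDl ?lte_fin//.
  by rewrite ge0_fin_numE ?measure_ge0// measure_lty.
have [n _ hn] := cB _ (open_ereal_lt' lt).
by exists n; exact: (hn n (leqnn n)).
Qed.

Definition regular_set A := forall e : R, 0 < e -> exists F U,
  [/\ closed F, open U, F `<=` A, A `<=` U & (nu (U `\` F) <= e%:E)%E].

(** The closed sets of points at distance at least [1 / (n + 1)] from the
    complement exhaust an open set. *)
Lemma regular_open O : open O -> regular_set O.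
Proof.
move=> oO e e0.
pose F (n : nat) := [set xi : circle R | forall eta, ~ O eta -> (n.+1%:R)^-1 <= chord xi eta].
have cF n : closed (F n).
  rewrite -[F n]setCK; apply: open_closedC.
  have -> : ~` F n = \bigcup_(eta in ~` O) [set xi | chord xi eta < (n.+1%:R)^-1].
    apply/seteqP; split => xi.
      move=> /existsNP[eta /not_implyP[nO]] /negP; rewrite -ltNge => h.
      by exists eta.
    by move=> [eta nO /=]; rewrite ltNge => /negP h1 h2; apply: h1; exact: h2.
  by apply: bigcup_open => eta _; exact: open_chord_lt.
have FO n : F n `<=` O.
  move=> xi Fxi; apply: contrapT => nO; have := Fxi xi nO.
  by rewrite /chord subrr Normc.normc0 leNgt invr_gt0 ltr0n.
have mF n := closed_circle_measurable (cF n).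
have mO := open_circle_measurable oO.
have [n nF] : exists n, (nu (O `\` F n) < nu set0 + e%:E)%E.
  apply: (measure_nonincreasing_lt (B := fun n => O `\` F n)) => //.
  - by move=> n; exact: measurableD.
  - move=> m n mn; apply/subsetPset; apply: setDS => xi Fxi eta nO.
    by apply: le_trans (Fxi _ nO); rewrite lef_pV2 ?posrE ?ltr0n// ler_nat.
  move=> xi Oxi; have [Ox _] := Oxi 0%N I.
  have [r r0 hr] := open_circle_ball oO Ox.
  pose N := Num.truncn r^-1.
  have [_ nFN] := Oxi N I; apply: nFN => eta nO.
  have rc : r <= chord xi eta by rewrite leNgt; apply/negP => /hr.
  apply: le_trans rc; rewrite invf_ple ?posrE ?ltr0n//.
  by rewrite ltW// truncnS_gt.
exists (F n), O; split => //.
by rewrite measure0 add0e in nF; exact: ltW.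
Qed.

Lemma regular_sigma_algebra : sigma_algebra setT regular_set.
Proof.
split.
- by move=> e e0; exists set0, set0; split=> //; [exact: closed0|exact: open0|
    rewrite setD0 measure0 lee_fin ltW].
- move=> A rA e e0; have [F [U [cF oU FA AU h]]] := rA e e0.
  exists (~` U), (~` F); split; rewrite ?setTD.
  + exact: open_closedC.
  + exact: closed_openC.
  + exact: subsetC.
  + exact: subsetC.
  + by rewrite setDE setCK setIC -setDE.
move=> A rA e e0; have e20 : 0 < e / 2 by rewrite divr_gt0.
have e2n n : 0 < e / 2 / (2 ^ n.+1)%:R by rewrite divr_gt0// ltr0n expn_gt0.
have [F HF] := choice (fun n => rA n _ (e2n n)).
have [U HU] := choice HF.
pose UU := \bigcup_n U n.
have oUU : open UU by apply: bigcup_open => n _; case: (HU n).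
have mF n : measurable (F n) by apply: closed_circle_measurable; case: (HU n).
have mU n : measurable (U n) by apply: open_circle_measurable; case: (HU n).
have mUU := open_circle_measurable oUU.
pose B N := UU `\` \bigcup_(k in `I_N) F k.
have mBN N : measurable (\bigcup_(k in `I_N) F k) by exact: bigcup_measurable.
(* A countable union of closed sets need not be closed, so it is truncated so
   far out that the rest accounts for at most half of the error. *)
have [N BN] : exists N, (nu (B N) < nu (UU `\` \bigcup_k F k) + (e / 2)%:E)%E.
  apply: measure_nonincreasing_lt => //.
  - by move=> N; exact: measurableD.
  - move=> m n mn; apply/subsetPset; apply: setDS => x [k /= km Fk].
    by exists k => //=; exact: leq_trans mn.
  - by apply: measurableD => //; exact: bigcupT_measurable.
  - move=> x Bx; split; first by case: (Bx 0%N I).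
    by move=> [k _ Fk]; case: (Bx k.+1 I) => _; apply; exists k => /=.
exists (\bigcup_(k in `I_N) F k), UU; split => //.
- by apply: closed_bigcup => [|k _]; [exact: finite_II|case: (HU k)].
- by move=> x [k _ Fk]; exists k => //; case: (HU k) => _ _ FA _ _; exact: FA.
- by move=> x [k _ Ak]; exists k => //; case: (HU k) => _ _ _ AU _; exact: AU.
rewrite (le_trans (ltW BN))// [in leRHS](splitr e) EFinD leeD2r//.
apply: le_trans (epsilon_trick0 predT (ltW e20)).
have mD n : measurable (U n `\` F n) by exact: measurableD.
have mDD : measurable (UU `\` \bigcup_k F k).
  by apply: measurableD => //; exact: bigcupT_measurable.
apply: le_trans (measure_sigma_subadditive nu _ mDD _) _; first exact: mD.
  move=> x [[k _ Uk] nF]; exists k => //; split => // Fk; apply: nF.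
  by exists k.
by apply: lee_nneseries => // n _; case: (HU n).
Qed.

Lemma measurable_regular A : measurable A -> regular_set A.
Proof.
apply: smallest_sub; first exact: regular_sigma_algebra.
by move=> O; exact: regular_open.
Qed.

Lemma closed_inner_regular A : measurable A -> (0 < nu A)%E ->
  exists F, [/\ closed F, F `<=` A & (0 < nu F)%E].
Proof.
move=> mA A0.
have fA : nu A \is a fin_num by rewrite ge0_fin_numE ?measure_ge0// measure_lty.
have a0 : 0 < fine (nu A) / 2 by rewrite divr_gt0// fine_gt0// A0 measure_lty.
have [F [U [cF oU FA AU h]]] := measurable_regular mA a0.
exists F; split => //.
rewrite lt_neqAle measure_ge0 andbT; apply/eqP => F0.
have mF := closed_circle_measurable cF.
have mU := open_circle_measurable oU.
have : (nu A <= nu F + nu (U `\` F))%E.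
  apply: (@le_trans _ _ (nu (F `|` (U `\` F)))).
    apply: le_measure; rewrite ?inE//.
      by apply: measurableU => //; exact: measurableD.
    by move=> x /AU Ux; have [Fx|Fx] := pselect (F x); [left|right].
  by apply: measureU2 => //; exact: measurableD.
rewrite -F0 add0e => /le_trans /(_ h).
rewrite -(fineK fA) lee_fin; rewrite -/(fine (nu A)) => hh.
have := a0; lra.
Qed.

End regularity.

(** * Thick points of a measure *)

Section net.
Variable R : realType.
Implicit Types (t s : R) (xi eta : circle R).

Lemma lipschitz1_is_derive (f df : R -> R) (t s : R) :
  (forall x : R, is_derive x 1 f (df x)) -> (forall x, `|df x| <= 1) ->
  `|f t - f s| <= `|t - s|.
Proof.
move=> fd df1; wlog st : t s / s <= t => [H|].
  by have [/H//|/ltW/H] := leP s t; rewrite distrC [leRHS]distrC.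
have [c _ ->] : exists2 c, c \in `[s, t] & f t - f s = df c * (t - s).
  apply: MVT_segment => //.
  by apply: derivable_within_continuous => x _; case: (fd x).
by rewrite normrM ler_piMl.
Qed.

Lemma circle_val_expi t : circle_val (expi t) = cos t +i* sin t.
Proof. by []. Qed.

Lemma chord_expi_le t s : chord (expi t) (expi s) <= 2 * `|s - t|.
Proof.
apply: le_trans (normc_le_ReIm _) _.
rewrite ReB ImB mulr_natl mulr2n lerD//.
  apply: (@lipschitz1_is_derive cos (fun x => - sin x)) => x.
  by rewrite normrN sin_max.
apply: (@lipschitz1_is_derive sin cos) => x.
exact: cos_max.
Qed.

Lemma expi_surj xi : exists2 t : R, 0 <= t < 8 & expi t = xi.
Proof.
have := circle_valMconj xi.
set x := complex.Re _; set y := complex.Im _ => xy.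
have x1 : -1 <= x <= 1.
  rewrite -ler_norml -(@ler_pXn2r _ 2)// ?nnegrE// real_normK ?num_real//.
  by rewrite expr1n -xy lerDl sqr_ge0.
have a0 := acos_ge0 x1; have api := acos_lepi x1.
have p4 : pi < 4 :> R by have := pihalf_lt2 R; lra.
have cx : cos (acos x) = x by rewrite acosK// in_itv.
have sx : sin (acos x) = `|y|.
  by rewrite sin_acos// (_ : 1 - x ^+ 2 = y ^+ 2) ?sqrtr_sqr//; lra.
have xiE : circle_val xi = x +i* y by rewrite /x /y; case: (circle_val xi).
have [y0|y0] := leP 0 y.
  exists (acos x); first by apply/andP; split; lra.
  by apply: circle_val_inj; rewrite xiE circle_val_expi cx sx ger0_norm.
exists (pi *+ 2 - acos x).
  by rewrite mulr2n; apply/andP; split; lra.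
apply: circle_val_inj; rewrite xiE circle_val_expi.
rewrite cosB sinB cos2pi sin2pi !mul1r !mul0r addr0 sub0r cx sx ltr0_norm//.
by rewrite opprK.
Qed.

(** Arguments range over [[0, 2 pi[], which is contained in [[0, 8[]. *)
Lemma circle_net (N : nat) xi : (0 < N)%N ->
  exists2 k, (k < 8 * N)%N & chord (expi (k%:R / N%:R)) xi <= 2 / N%:R.
Proof.
move=> N0; have [t /andP[t0 t8] <-] := expi_surj xi.
have N0' : 0 < N%:R :> R by rewrite ltr0n.
have tN0 : 0 <= t * N%:R by rewrite mulr_ge0.
have /andP[h1 h2] := truncn_itv tN0.
exists (Num.truncn (t * N%:R)).
  by rewrite -(ltr_nat R) (le_lt_trans h1)// natrM ltr_pM2r.
apply: le_trans (chord_expi_le _ _) _; rewrite ler_pM2l//.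
have -> : t - (Num.truncn (t * N%:R))%:R / N%:R = (t * N%:R - (Num.truncn (t * N%:R))%:R) / N%:R.
  by field; rewrite gt_eqF.
rewrite ger0_norm ?divr_ge0 ?subr_ge0 ?ler0n//.
rewrite -[leRHS]mul1r ler_pM2r ?invr_gt0//.
by rewrite lerBlDl -natr1 in h2 *; rewrite ltW// addrC.
Qed.

Lemma measurable_chord_ball xi (r : R) : measurable [set eta | chord xi eta <= r].
Proof.
have := measurable_chord xi measurableT (measurable_itv `]-oo, r]).
by rewrite setTI; congr measurable; apply/seteqP; split => eta /=; rewrite in_itv.
Qed.

End net.

Section regular_points.
Variables (R : realType) (nu : {measure set (circle R) -> \bar R}).
Variable c : R.
Hypothesis c0 : 0 < c.

(** The mass [c 8^-n] of a ball of radius about [4^-n] is of order [3/2] in the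
    radius: above [1], so that few points fail the condition, and below [2], the
    order of the kernel of the potential. *)
Definition thick_points : set (circle R) := [set eta | forall n : nat,
  ((c / 8 ^+ n)%:E <= nu [set zeta | (chord eta zeta <= 4 / 4 ^+ n)%R])%E].

(** At scale [4^-n] a net of [8 * 4^n] points suffices, so discarding the balls of
    mass below [c 8^-n] costs at most [8 c 2^-n], which sums to [16 c].  The
    radius doubles when a ball of the net is replaced by a ball centred at the
    given point. *)
Lemma exists_thick_points : exists G : set (circle R),
  [/\ measurable G, G `<=` thick_points & (nu (~` G) <= (16 * c)%:E)%E].
Proof.
pose ctr (n k : nat) : circle R := expi (k%:R / (4 ^ n)%:R).
pose B n k := [set eta | chord (ctr n k) eta <= 2 / (4 ^ n)%:R].
pose bad n k := if (nu (B n k) < (c / 8 ^+ n)%:E)%E then B n k else set0.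
have mB n k : measurable (B n k) by exact: measurable_chord_ball.
have mbad n k : measurable (bad n k) by rewrite /bad; case: ifP.
pose Bad n := \big[setU/set0]_(k < 8 * 4 ^ n) bad n k.
have mBad n : measurable (Bad n) by exact: bigsetU_measurable.
have nuBad n : (nu (Bad n) <= ((16 * c) / (2 ^ n.+1)%:R)%:E)%E.
  apply: (@le_trans _ _ (\sum_(k < 8 * 4 ^ n) nu (bad n k))%E).
    by apply: content_subadditive => // k _.
  apply: (@le_trans _ _ (\sum_(k < 8 * 4 ^ n) (c / 8 ^+ n)%:E)%E).
    apply: lee_sum => k _; rewrite /bad; case: ifPn => [/ltW//|_].
    by rewrite measure0 lee_fin divr_ge0// ltW.
  rewrite sumEFin lee_fin sumr_const card_ord -[_ *+ (8 * 4 ^ n)]mulr_natl natrM !natrX.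
  rewrite (_ : 8 ^+ n = 4 ^+ n * 2 ^+ n :> R); last by rewrite -exprMn; congr (_ ^+ n); ring.
  rewrite le_eqVlt; apply/orP; left; apply/eqP; rewrite exprS.
  by field; rewrite !expf_neq0.
exists (~` \bigcup_n Bad n); split.
- by apply: measurableC; exact: bigcupT_measurable.
- move=> eta nbad n.
  have [k kN keta] := circle_net eta (expn_gt0 4 n : (0 < 4 ^ n)%N).
  have Beta : B n k eta by [].
  have : ~~ (nu (B n k) < (c / 8 ^+ n)%:E)%E.
    apply/negP => h; apply: nbad; exists n => //.
    rewrite /Bad -bigcup_mkord; exists k => //=.
    by rewrite /bad h.
  rewrite -leNgt => /le_trans; apply; apply: le_measure; rewrite ?inE//.
    exact: measurable_chord_ball.
  move=> zeta /= Bz; apply: le_trans (chord_triangle (ctr n k) _ _) _.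
  have -> : 4 / 4 ^+ n = 2 / (4 ^ n)%:R + 2 / (4 ^ n)%:R :> R.
    by rewrite natrX -mulrDl; congr (_ / _); ring.
  by rewrite lerD// chordC.
rewrite setCK; apply: le_trans (measure_sigma_subadditive nu mBad _ _) _.
- exact: bigcupT_measurable.
- exact: subset_refl.
have c16 : 0 <= 16 * c by rewrite mulr_ge0// ltW.
apply: le_trans (epsilon_trick0 predT c16).
by apply: lee_nneseries => // n _; exact: nuBad.
Qed.

(** A ball of radius [4 * 4^-n] about a thick point within [4 * 4^-n] of [xi] lies
    in the ball of radius [8 * 4^-n] about [xi], and
    [2 / (8 * 4^-n)^2 * c 8^-n = c / 32 * 2^n]. *)
Lemma potential_ge_thick (F : set (circle R)) (xi : circle R) (n : nat) :
  F `<=` thick_points -> (circle_dist xi F < (4 / 4 ^+ n)%:E)%E ->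
  ((c / 32 * 2 ^+ n)%:E <= potential nu xi)%E.
Proof.
move=> Fthick /circle_dist_lt[eta Feta]; rewrite lte_fin => xe.
have r0 : 0 < 8 / 4 ^+ n :> R by rewrite divr_gt0 ?exprn_gt0.
have := potential_ge_near nu (measurable_chord_ball eta (4 / 4 ^+ n)) r0.
move=> /(_ xi) H; apply: le_trans (H _); last first.
  move=> zeta /= ez; apply: le_trans (chord_triangle eta _ _) _.
  have -> : 8 / 4 ^+ n = 4 / 4 ^+ n + 4 / 4 ^+ n :> R.
    by rewrite -mulrDl; congr (_ / _); ring.
  by rewrite lerD// ltW.
apply: (@le_trans _ _ ((2 / (8 / 4 ^+ n) ^+ 2)%:E * (c / 8 ^+ n)%:E)%E); last first.
  by apply: lee_wpmul2l; [rewrite lee_fin divr_ge0 ?sqr_ge0|exact: Fthick].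
rewrite -EFinM lee_fin (_ : 8 ^+ n = 4 ^+ n * 2 ^+ n :> R); last first.
  by rewrite -exprMn; congr (_ ^+ n); ring.
rewrite (_ : 4 ^+ n = 2 ^+ n * 2 ^+ n :> R); last first.
  by rewrite -exprMn; congr (_ ^+ n); ring.
rewrite le_eqVlt; apply/orP; left; apply/eqP.
by field; rewrite expf_neq0.
Qed.

Lemma dyadic_scale (d : R) : 0 < d <= 2 ->
  exists n : nat, d < 4 / 4 ^+ n /\ 1 <= d * 4 ^+ n.
Proof.
move=> /andP[d0 d2].
have exm : exists m : nat, 4 / 4 ^+ m <= d.
  exists (Num.truncn (4 / d)).+1; rewrite ler_pdivrMr ?exprn_gt0// mulrC -ler_pdivrMr//.
  apply: le_trans (ltW (truncnS_gt _)) _.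
  by rewrite -natrX ler_nat ltnW// ltn_expl.
case: (ex_minnP exm) => -[|n] hn minn.
  by move: hn; rewrite expr0 divr1 => h; lra.
exists n; split.
  by rewrite ltNge; apply/negP => /minn; rewrite ltnn.
move: hn; rewrite ler_pdivrMr ?exprn_gt0// exprS mulrCA => h.
by rewrite -(@ler_pM2l _ 4)// mulr1.
Qed.

(** At the scale [4^-n] comparable to the distance [d], the potential is at least
    [c / 32 * 2^n], hence at least [c / 32 * d^(-1/2)]; on [F] itself all scales
    are available and the potential is infinite. *)
Lemma abs_lne_dist_le_potential (F : set (circle R)) (xi : circle R) :
  F !=set0 -> F `<=` thick_points ->
  (`|lne (circle_dist xi F)| <=
    (ln 2 + `|ln ((32 / c) ^+ 2)|)%:E + 2%:E * `|lne (potential nu xi)|)%E.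
Proof.
move=> F0 Fthick; have [d [dE d0 d2]] := circle_dist_fin xi F0.
rewrite dE; apply: abs_lne_dist_le.
- by rewrite d0.
- by rewrite exprn_gt0// divr_gt0.
- by apply: integral_ge0 => eta _; exact: potential_kernel_ge0.
- move=> d00; apply/eqP; rewrite -leye_eq leNgt; apply/negP => pfin.
  have pfin' : potential nu xi \is a fin_num.
    by rewrite ge0_fin_numE//; apply: integral_ge0 => eta _; exact: potential_kernel_ge0.
  pose n := (Num.truncn (fine (potential nu xi) / (c / 32))).+1.
  have := potential_ge_thick (n := n) (xi := xi) Fthick.
  rewrite dE d00 lte_fin divr_gt0 ?exprn_gt0// => /(_ isT).
  apply/negP; rewrite -ltNge -(fineK pfin') lte_fin -ltr_pdivrMl ?divr_gt0// mulrC.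
  apply: lt_trans (truncnS_gt _) _; rewrite -natrX ltr_nat -/n.
  exact: ltn_expl.
move=> dp pfin; have [n [dn nd]] : exists n : nat, d < 4 / 4 ^+ n /\ 1 <= d * 4 ^+ n.
  by apply: dyadic_scale; rewrite dp.
have := potential_ge_thick (n := n) (xi := xi) Fthick; rewrite dE lte_fin => /(_ dn).
rewrite -(fineK pfin) lee_fin; set u := fine _ => hu.
have c32 : 0 < c / 32 by rewrite divr_gt0.
have hu2 : (c / 32) ^+ 2 * 4 ^+ n <= u ^+ 2.
  rewrite (_ : 4 = 2 ^+ 2 :> R); last by ring.
  rewrite -exprM mulnC exprM -exprMn ler_pXn2r// nnegrE.
    by rewrite mulr_ge0 ?exprn_ge0// ltW.
  by rewrite (le_trans _ hu)// mulr_ge0 ?exprn_ge0// ltW.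
apply: le_trans nd _.
have -> : d * 4 ^+ n = (32 / c) ^+ 2 * d * ((c / 32) ^+ 2 * 4 ^+ n).
  by field; rewrite gt_eqF.
by rewrite ler_pM2l// mulr_gt0// exprn_gt0// divr_gt0.
Qed.

End regular_points.

(** * Invisible measures *)

Section visibility.
Variables (R : realType) (p : R).
Hypothesis p0 : 0 < p.
Local Open Scope ereal_scope.

Lemma in_Lp_angular_derivativeE (nu : {measure set (circle R) -> \bar R}) :
  nu setT < +oo ->
  in_Lp p (fun xi => lne (abs_angular_derivative (singular_inner nu) xi)) <->
  measurable_fun setT (fun xi => lne (potential nu xi)) /\
  \int[circle_measure R]_xi (`|lne (potential nu xi)| `^ p) < +oo.
Proof.
move=> nu_fin; rewrite /in_Lp.
under eq_fun do rewrite abs_angular_derivative_potential//.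
by split=> -[? /(Lnorm_lty _ _ p0)].
Qed.

(** The restriction [nu] of [mu] to [E] violates invisibility: its mass lies at
    distance between [dist(xi, E)] and [2] from [xi], which bounds its potential
    from both sides. *)
Lemma beurling_carleson_visible (mu : {finite_measure set (circle R) -> \bar R})
    (E : set (circle R)) :
  beurling_carleson p E -> mu E != 0 -> ~ invisible p mu.
Proof.
move=> [cE _ EBC] muE inv.
have mE := closed_circle_measurable cE.
have muEfin : mu E < +oo by rewrite ltey_eq fin_num_measure.
pose nu : {measure set (circle R) -> \bar R} := mfrestr mE muEfin.
have mpot : measurable_fun setT (fun xi => lne (potential nu xi)).
  apply: measurableT_comp (@measurable_lne R) _.
  exact: (measurable_potential (mfrestr mE muEfin)).
have nuE A : nu A = mu (A `&` E) by [].
have nuT : nu setT = mu E by rewrite nuE setTI.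
have nu_fin : nu setT < +oo by rewrite nuT.
have E0 : E !=set0 by apply/set0P; apply: contraNneq muE => ->; rewrite measure0.
pose m := fine (nu setT).
have mE' : nu setT = m%:E by rewrite /m fineK// ge0_fin_numE// measure_ge0.
have m0 : (0 < m)%R.
  by rewrite -lte_fin -mE' lt_neqAle measure_ge0 andbT eq_sym nuT.
have nu0 : nu setT != 0 by rewrite nuT.
apply: (inv nu nu0).
- move=> A mA; change (mu (A `&` E) <= mu A); apply: le_measure; rewrite ?inE//; exact: measurableI.
apply/in_Lp_angular_derivativeE => //; split; first exact: mpot.
apply: (integral_poweR_lty (C := `|ln (m / 2)| + `|ln (2 * m)|) p0 _ _ _ _ EBC).
- by rewrite addr_ge0.
- exact: mpot.
- exact: measurableT_comp (@measurable_lne R) (measurable_circle_dist E).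
move=> xi; have [d [dE d0 d2]] := circle_dist_fin xi E0; rewrite dE.
apply: abs_lne_le_of_bounds => //; first by rewrite divr_gt0.
  have := @potential_ge_near R nu xi 2 setT measurableT.
  rewrite mE' -EFinM (_ : (2 / 2 ^+ 2 * m = m / 2)%R); last by field.
  by apply=> // eta _; exact: chord_le2.
move=> dp; have := @potential_le_far R nu xi d E mE dp.
rewrite mE' -EFinM (_ : (2 / d ^+ 2 * m = 2 * m / d ^+ 2)%R); last by field; rewrite gt_eqF.
apply; first by rewrite nuE setICl measure0.
by move=> eta Eeta; rewrite -lee_fin -dE; exact: circle_dist_le.
Qed.

(** Inner regularity, applied to the thick points inside the null carrier [N],
    which have at least half of the mass. *)
Lemma exists_beurling_carleson (nu : {measure set (circle R) -> \bar R})
    (N : set (circle R)) :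
  nu setT != 0 -> nu setT < +oo ->
  measurable N -> nu (~` N) = 0 -> circle_measure R N = 0 ->
  in_Lp p (fun xi => lne (abs_angular_derivative (singular_inner nu) xi)) ->
  exists2 F, beurling_carleson p F & 0 < nu F.
Proof.
move=> nu0 nu_fin mN nuN cN /(in_Lp_angular_derivativeE nu_fin)[mpot ipot].
pose m := fine (nu setT).
have mE : nu setT = m%:E by rewrite /m fineK// ge0_fin_numE// measure_ge0.
have m0 : (0 < m)%R.
  by rewrite -lte_fin -mE lt_neqAle measure_ge0 andbT eq_sym.
(* With [c = m / 32] at most half of the mass [m] is discarded. *)
have c0 : (0 < m / 32)%R by rewrite divr_gt0.
have [G [mG Gthick nuG]] := exists_thick_points nu c0.
have mGN : measurable (G `&` N) by exact: measurableI.
have GN0 : 0 < nu (G `&` N).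
  rewrite lt_neqAle measure_ge0 andbT; apply/eqP => GN0.
  have : nu setT <= nu (G `&` N) + nu (~` G) + nu (~` N).
    have mGc := measurableC mG; have mNc := measurableC mN.
    rewrite (_ : setT = (G `&` N `|` ~` G) `|` ~` N); last first.
      by apply/seteqP; split=> // x _; have [Gx|] := pselect (G x);
        have [Nx|] := pselect (N x) => *; [left; left|right|left; right|right].
    apply: le_trans (measureU2 nu _ _) _ => //; first exact: measurableU.
    by rewrite leeD2r// measureU2.
  rewrite -GN0 add0e nuN adde0 mE => /le_trans /(_ nuG).
  by rewrite lee_fin; lra.
have [F [cF FGN F0]] := closed_inner_regular nu_fin mGN GN0.
exists F => //; split => //.
  apply/eqP; rewrite -measure_le0 -cN; apply: le_measure; rewrite ?inE//.
    exact: closed_circle_measurable.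
  by move=> x /FGN[].
apply: (integral_poweR_lty (C := ln 2 + `|ln ((32 / (m / 32)) ^+ 2)|) p0 _ _ mpot _ ipot).
- by rewrite addr_ge0// ln_ge0// ler1n.
- exact: measurableT_comp (@measurable_lne R) (measurable_circle_dist F).
move=> xi; apply: abs_lne_dist_le_potential => //.
  by apply/set0P; apply: contraTneq F0 => ->; rewrite measure0 ltxx.
by move=> x /FGN[Gx _]; exact: Gthick.
Qed.

End visibility.

Theorem corollary1p4 (R : realType) (p : R)
    (mu : {finite_measure set (circle R) -> \bar R}) :
  0 < p -> mutually_singular mu (circle_measure R) ->
  (invisible p mu <->
   forall E : set (circle R), beurling_carleson p E -> mu E = 0%E).
Proof.
move=> p0 [N [mN muN cN]]; split.
  move=> inv E EBC; apply/eqP; apply/negP => /negP muE.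
  exact: beurling_carleson_visible EBC muE inv.
move=> H nu nu0 nule nuLp.
have nu_fin : (nu setT < +oo)%E.
  by rewrite (le_lt_trans (nule _ _))// ltey_eq fin_num_measure.
have nuN : nu (~` N) = 0%E.
  by apply/eqP; rewrite -measure_le0 -muN; apply: nule; exact: measurableC.
have [F FBC] := exists_beurling_carleson p0 nu0 nu_fin mN nuN cN nuLp.
rewrite ltNge => /negP; apply; rewrite -(H F FBC); apply: nule.
by case: FBC => cF _ _; exact: closed_circle_measurable.
Qed.
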